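(* Let $\omega\in C^\infty(\Omega)$ with $|\omega|_{W^j_\infty(\Omega)}\le C d^{-j}$ for $0\le j\le r$. Then for each $\chi\in S_h^r$, there exists $\eta\in S_h^r$ such that for each $T\in\mathcal{T}_h$ satisfying $d\ge h_T$, $$\|\omega^2\chi-\eta\|_{H^1(T)}\le C\Big(\frac{h_T}{d}\,\|\nabla(\omega\chi)\|_{L_2(T)}+\frac{h_T}{d^2}\,\|\chi\|_{L_2(T)}\Big).$$
   Context: $\Omega\subset\mathbb{R}^n$ is a polyhedral domain and $\mathcal{T}_h$ is a simplicial decomposition of $\Omega$. For $T\in\mathcal{T}_h$, $h_T$ denotes the diameter of $T$. The elements of $\mathcal{T}_h$ are shape-regular: each simplex $T\in\mathcal{T}_h$ contains a ball of diameter $c_1h_T$ and is contained in a ball of radius $C_1h_T$, where $c_1$ and $C_1$ are fixed. $S_h^r$ is a standard Lagrange finite element space consisting of continuous piecewise polynomials (with respect to $\mathcal{T}_h$) of degree $r-1$. $d>0$ is a real parameter. $C$ denotes a generic constant, not necessarily the same at each occurrence. Standard notation for Sobolev norms and seminorms is used: $\|u\|_{H^1(D)}=(\int_D(u^2+|\nabla u|^2)\,dx)^{1/2}$ and $|u|_{W^k_p(D)}=(\sum_{|\alpha|=k}\|D^\alpha u\|_{L_p(D)}^p)^{1/p}$, with the usual modification for $p=\infty$. *)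

(* Defs.v *)
(* R^n is 'rV[R]_n over an abstract R : realType. *)
From HB Require Import structures.
From mathcomp Require Import all_boot all_order all_algebra.
From mathcomp Require mpoly.
(* The notations of mpoly clash with those of MathComp-Analysis, and some of
   its names (measure, isMeasure) have to be shadowed by the latter. *)
Export -(notations) mpoly.
From mathcomp Require Import all_classical all_reals all_analysis.
Export numFieldNormedType.Exports.

Set Implicit Arguments.
Unset Strict Implicit.
Unset Printing Implicit Defensive.

Import Order.TTheory GRing.Theory Num.Theory.
Local Open Scope classical_set_scope.
Local Open Scope ring_scope.

(* The sigma-algebra generated by the coordinates is the Borel one. *)
Definition rV_display : measure_display. Proof. exact: default_measure_display. Qed.

Section rV_measurable.
Context (R : realType) (n : nat).

Definition rV_coord (i : 'I_n) (x : 'rV[R]_n) : measurableTypeR R := x ord0 i.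

Let rV_set0 : g_sigma_preimage rV_coord set0.
Proof. exact: sigma_algebra0. Qed.

Let rV_setC A : g_sigma_preimage rV_coord A -> g_sigma_preimage rV_coord (~` A).
Proof. exact: sigma_algebraC. Qed.

Let rV_bigcup (F : (set 'rV[R]_n)^nat) :
  (forall i, g_sigma_preimage rV_coord (F i)) ->
  g_sigma_preimage rV_coord (\bigcup_i (F i)).
Proof. exact: sigma_algebra_bigcup. Qed.

HB.instance Definition _ := @isMeasurable.Build rV_display
  'rV[R]_n (g_sigma_preimage rV_coord) rV_set0 rV_setC rV_bigcup.

End rV_measurable.

Definition rV_cons (R : realType) (n : nat)
    (p : 'rV[R]_n * measurableTypeR R) : 'rV[R]_n.+1 :=
  row_mx (\row_(_ < 1) (p.2 : R)) p.1.

Lemma measurable_rV_cons (R : realType) (n : nat) :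
  measurable_fun [set: 'rV[R]_n * measurableTypeR R] (@rV_cons R n).
Proof.
move=> _ A mA; rewrite setTI.
suff : g_sigma_preimage (@rV_coord R n.+1) `<=`
    [set B | measurable (@rV_cons R n @^-1` B)] by exact.
apply: smallest_sub.
  split=> /=.
  - by rewrite preimage_set0; exact: measurable0.
  - by move=> B mB; rewrite setTD preimage_setC; exact: measurableC.
  - by move=> F mF; rewrite preimage_bigcup; exact: bigcup_measurable.
move=> B; rewrite -bigcup_seq => -[i _ [D mD <-]] /=.
rewrite setTI -comp_preimage.
case: (splitP (i : 'I_(1 + n))) => k ik.
- rewrite (_ : _ \o _ = snd).
    by rewrite -[X in measurable X]setTI; exact: measurable_snd.
  apply/funext => p /=; rewrite /rV_coord /rV_cons.
  rewrite (_ : i = lshift n k); last exact: val_inj.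
  by apply: etrans (row_mxEl _ _ _ _) _; rewrite mxE.
- rewrite (_ : _ \o _ = @rV_coord R n k \o fst).
    rewrite comp_preimage -[X in measurable X]setTI.
    apply: measurable_fst => //; apply: sub_sigma_algebra.
    rewrite -bigcup_seq; exists k => /=; first by rewrite mem_index_enum.
    by exists D => //; rewrite setTI.
  apply/funext => p /=; rewrite /rV_coord /rV_cons.
  rewrite (_ : i = rshift 1 k); last exact: val_inj.
  exact: row_mxEr.
Qed.

Section product_with_lebesgue.
Context (R : realType) (n : nat) (mu : {measure set 'rV[R]_n -> \bar R}).
Local Open Scope ereal_scope.

Definition rV_prod : set 'rV[R]_n.+1 -> \bar R :=
  pushforward (mu \x (@lebesgue_measure R)) (@rV_cons R n).

Let rV_prod0 : rV_prod set0 = 0.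
Proof. exact: (measure0 (mu \x (@lebesgue_measure R))). Qed.

Let rV_prod_ge0 A : 0 <= rV_prod A.
Proof. exact: (measure_ge0 (mu \x (@lebesgue_measure R))). Qed.

Let rV_prod_sigma_additive : semi_sigma_additive rV_prod.
Proof.
have mf := @measurable_rV_cons R n.
exact: measure_semi_sigma_additive.
Qed.

HB.instance Definition _ := isMeasure.Build _ _ _ rV_prod
  rV_prod0 rV_prod_ge0 rV_prod_sigma_additive.

End product_with_lebesgue.

(* Lebesgue measure on R^n: the n-fold product of the one on R. *)
Fixpoint lebesgue_rV (R : realType) (n : nat) :
    {measure set 'rV[R]_n -> \bar R} :=
  match n with
  | 0 => dirac (0 : 'rV[R]_0)
  | m.+1 => rV_prod (lebesgue_rV R m)
  end.

Section euclidean.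
Context (R : realType) (n : nat).
Implicit Types (x y : 'rV[R]_n) (A : set 'rV[R]_n).

(* The library norm on 'rV[R]_n is the sup norm. *)
Definition enorm x : R := Num.sqrt (\sum_(i < n) x ord0 i ^+ 2).

Definition eball x (e : R) : set 'rV[R]_n := [set y | enorm (y - x) < e].

Definition diameter A : R := sup [set enorm (x - y) | x in A & y in A].

End euclidean.

Section derivatives.
Context (R : realType) (n : nat).
Implicit Types (u : 'rV[R]_n -> R) (D : set 'rV[R]_n).

Definition partial (i : 'I_n) u : 'rV[R]_n -> R :=
  fun x => 'D_(delta_mx ord0 i) u x.

Definition partials (s : seq 'I_n) u : 'rV[R]_n -> R := foldr partial u s.

Definition Dmulti (a : multinom n) u : 'rV[R]_n -> R :=
  partials (flatten [seq nseq (a i) i | i <- enum 'I_n]) u.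

Definition gradient u (x : 'rV[R]_n) : 'rV[R]_n := \row_i partial i u x.

(* Only meant for open D: all iterated partial derivatives exist and are
   continuous on D. *)
Definition smooth D u : Prop :=
  forall s : seq 'I_n,
    {within D, continuous (partials s u)} /\
    forall i x, D x -> derivable (partials s u) x (delta_mx ord0 i).

End derivatives.

(* Derivatives being the classical ones, D is meant to be open: the norms on a
   closed simplex T are taken on its interior, from which T differs by a null
   set. *)
Section norms.
Context (R : realType) (n : nat).
Implicit Types (u : 'rV[R]_n -> R) (D : set 'rV[R]_n) (p : \bar R).
Local Open Scope ereal_scope.

Definition Lpnorm p D u : \bar R := 'N[lebesgue_rV R n]_p[EFin \o (u \_ D)].

Definition L2norm D u : \bar R := Lpnorm 2%:E D u.

Definition H1norm D u : \bar R :=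
  (\int[lebesgue_rV R n]_(x in D)
     (u x ^+ 2 + enorm (gradient u x) ^+ 2)%:E) `^ 2^-1.

(* |u|_{W^k_oo(D)}: the maximum over the multi-indices of length k. *)
Definition Wseminorm_oo (k : nat) D u : \bar R :=
  ereal_sup [set Lpnorm +oo D (Dmulti a u) | a in [set a | mdeg a = k]].

End norms.

Section meshes.
Context (R : realType) (n : nat).
(* A simplex is given by the matrix whose n+1 rows are its vertices. *)
Implicit Types (T : 'M[R]_(n.+1, n)) (Th : seq 'M[R]_(n.+1, n))
  (D : set 'rV[R]_n).

Definition face T (S : {set 'I_n.+1}) : set 'rV[R]_n :=
  [set x | exists l : 'rV[R]_n.+1,
     [/\ forall i, 0 <= l ord0 i,
         forall i, i \notin S -> l ord0 i = 0,
         \sum_i l ord0 i = 1 & x = l *m T]].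

Definition simplex T : set 'rV[R]_n := face T [set: 'I_n.+1]%SET.

Definition affinely_independent T : Prop :=
  forall l : 'rV[R]_n.+1, \sum_i l ord0 i = 0 -> l *m T = 0 -> l = 0.

Definition frontier D : set 'rV[R]_n := closure D `\` D°.

(* The boundary is a finite union of polytopes. Cutting each of them into
   simplices, and repeating vertices in those of dimension less than n, they
   can all be given by n+1 points. *)
Definition polyhedral_domain D : Prop :=
  [/\ open D, connected D, D !=set0, bounded_set D &
      exists s : seq 'M[R]_(n.+1, n),
        frontier D = \bigcup_(V in [set` s]) simplex V].

(* [face T set0] is empty, so that disjoint simplices are allowed. The last
   clause says that the mesh resolves the boundary of the domain; it follows
   from the other ones unless D has slits, i.e., unless D <> (closure D)°. *)
Definition simplicial_decomposition D Th : Prop :=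
  [/\ forall T, T \in Th -> affinely_independent T,
      closure D = \bigcup_(T in [set` Th]) simplex T,
      forall T T', T \in Th -> T' \in Th ->
        exists S S' : {set 'I_n.+1},
          simplex T `&` simplex T' = face T S /\ face T S = face T' S' &
      forall x, frontier D x ->
        exists T, T \in Th /\
        exists S : {set 'I_n.+1}, face T S x /\ face T S `<=` frontier D].

Definition hmesh T : R := diameter (simplex T).

Definition shape_regular (c1 C1 : R) Th : Prop :=
  forall T, T \in Th ->
    (exists x, eball x (c1 * hmesh T / 2) `<=` simplex T) /\
    (exists x, simplex T `<=` eball x (C1 * hmesh T)).

(* Continuous functions on D that are polynomials of degree at most r - 1 on
   each element ([msize p] is 1 + the total degree of p). They are considered
   as functions on the open set D only: their values elsewhere are junk. *)
Definition lagrange_space (r : nat) D Th (chi : 'rV[R]_n -> R) : Prop :=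
  {within D, continuous chi} /\
  forall T, T \in Th ->
    exists p : mpoly n R, (msize p <= r)%N /\
      forall x, simplex T x -> D x -> chi x = meval (fun i => x ord0 i) p.

End meshes.

(* Main.v *)
Require Import Defs.
From HB Require Import structures.
From mathcomp Require Import all_boot all_order all_algebra.
From mathcomp Require Import all_classical all_reals all_analysis.
From mathcomp Require Import ring lra zify.
Import Order.TTheory GRing.Theory Num.Theory.
Local Open Scope classical_set_scope.
Local Open Scope ring_scope.

(** The function [eta] is the piecewise Lagrange interpolant [I] of degree
    [N = r - 1] of [omega ^+ 2 * chi]. Consider an element [T] of diameter [h], the
    centre [y] of a ball inscribed in it, and the Taylor expansion
    [omega ^+ 2 = (omega y) ^+ 2 + l + rho] at [y], with [l] linear. The bounds on
    the derivatives of [omega] show that [rho] is of size [h ^+ 2 / d ^+ 2] and [l]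
    of size [`|omega y| * h / d], and that their Lipschitz constants have one
    power of [h] less ([remainder_bddlip]). Interpolation reproduces polynomials of
    degree [N], in particular [(omega y) ^+ 2 * chi] and [l * chi y]. Hence the
    error on [T] is [E - I E] for [E = rho * chi + l * (chi - chi y)]. Let [M] and
    [G] be the maxima of [chi] and of its gradient near [y]. Then [E] is of size
    [h * Y] and has a Lipschitz constant of order [Y], where
    [Y = (h / d) * `|omega y| * G + (h / d ^+ 2) * M], and interpolation is stable
    in this sense ([ex_interp_stable], [error_bddlip]). So the [H^1] norm of the
    error is at most a multiple of [Y] times the square root of the volume of [T].

    It remains to bound [M] and [G] by integrals. All norms of polynomials of
    bounded degree on a cube are equivalent, and a polynomial stays within a
    factor 2 of its maximum on a cube of size comparable to [h] ([grid_control],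
    [polys_max]); so [M] is controlled by the [L_2] norm of [chi]. On a cube where
    a partial derivative of [chi] is at least [G / 2], the product rule shows that
    the gradient of [omega * chi] is at least [`|omega y| * G / 2 - C * M / d], and
    so [`|omega y| * G] is controlled as well ([local_estimate]).

    The interpolants have to match across faces. They are sums over the nodes
    [a / N], for [a] in [lattice], of Silvester's products of binomial
    coefficients; their exactness is a form of Vandermonde's identity
    ([lattice_sum_prod]). As [chi] and [omega] live on the open set [Omega], the
    value at a node on the frontier is that of a Lipschitz extension from the
    interior of [T]. If a face of [T] meets [Omega], then its relative interior
    lies in [Omega], because the mesh resolves the frontier ([face_frontier]); so
    two elements that share this face extend the same function to it. They also
    have the same vertices there ([face_vertex]), hence the same nodes and the same
    interpolant ([nodes_face_eq], [local_interp_conform]). *)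

Set Implicit Arguments.
Unset Strict Implicit.
Unset Printing Implicit Defensive.

(** * Interpolation on the principal lattice of a simplex *)

Section silvester.
Context (R : numFieldType).
Implicit Types (x y : R) (k N : nat).

Definition falling x k : R := \prod_(i < k) (x - i%:R).

Definition gen_binomial x k : R := falling x k / k`!%:R.

Lemma fallingS x k : falling x k.+1 = falling x k * (x - k%:R).
Proof. by rewrite /falling big_ord_recr. Qed.

Lemma falling_lt (a k : nat) : (a < k)%N -> falling a%:R k = 0.
Proof.
by move=> ak; rewrite /falling (bigD1 (Ordinal ak))//= subrr mul0r.
Qed.

Lemma falling_addl x b k : falling x (b + k) = falling x b * falling (x - b%:R) k.
Proof.
elim: k => [|k IHk]; first by rewrite addn0 /falling big_ord0 mulr1.
by rewrite addnS !fallingS IHk natrD opprD addrA mulrA.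
Qed.

Lemma falling_fact (a : nat) : falling a%:R a = a`!%:R.
Proof.
elim: a => [|a IHa]; first by rewrite /falling big_ord0.
rewrite factS natrM -IHa /falling big_ord_recl subr0; congr (_ * _).
by apply: eq_bigr => i _; rewrite lift0 -[in LHS]natr1 -natr1; ring.
Qed.

Lemma gen_binomial0 x : gen_binomial x 0 = 1.
Proof. by rewrite /gen_binomial /falling big_ord0 fact0 divr1. Qed.

Lemma gen_binomial_nat (a : nat) : gen_binomial a%:R a = 1.
Proof. by rewrite /gen_binomial falling_fact divff// pnatr_eq0 -lt0n fact_gt0. Qed.

Lemma gen_binomial_lt (a k : nat) : (a < k)%N -> gen_binomial a%:R k = 0.
Proof. by move=> ak; rewrite /gen_binomial falling_lt// mul0r. Qed.

Lemma gen_binomialS x k : k.+1%:R * gen_binomial x k.+1 = (x - k%:R) * gen_binomial x k.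
Proof.
rewrite /gen_binomial fallingS factS natrM; field.
by rewrite !(pnatr_eq0, nat1r) -lt0n fact_gt0.
Qed.

(** Both sides satisfy the recurrence [gen_binomialS]: split [x + y - N] as
    [(x - k) + (y - (N - k))] in the [k]-th term and shift the first half of
    the sum. *)
Lemma vandermonde x y N :
  \sum_(k < N.+1) gen_binomial x k * gen_binomial y (N - k) = gen_binomial (x + y) N.
Proof.
elim: N => [|N IHN]; first by rewrite big_ord1 !gen_binomial0 mulr1.
have N0 : N.+1%:R != 0 :> R by rewrite pnatr_eq0.
apply: (mulfI N0); rewrite gen_binomialS -IHN !mulr_sumr.
transitivity (\sum_(k < N.+1) k.+1%:R * gen_binomial x k.+1 * gen_binomial y (N - k)
  + \sum_(k < N.+1)
      gen_binomial x k * ((N.+1 - k)%:R * gen_binomial y (N.+1 - k))); last first.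
  rewrite -big_split/=; apply: eq_bigr => k _.
  have kN : (k <= N)%N by rewrite -ltnS.
  by rewrite gen_binomialS subSn// gen_binomialS natrB//; ring.
transitivity (\sum_(k < N.+2) k%:R * gen_binomial x k * gen_binomial y (N.+1 - k)
  + \sum_(k < N.+2) gen_binomial x k * ((N.+1 - k)%:R * gen_binomial y (N.+1 - k))).
  rewrite -big_split/=; apply: eq_bigr => k _.
  have kN : (k <= N.+1)%N by rewrite -ltnS.
  by rewrite natrB//; ring.
congr (_ + _).
  by rewrite big_ord_recl/= !mul0r add0r.
by rewrite big_ord_recr/= subnn mul0r mulr0 addr0.
Qed.

(** The analogue of absorbing a falling factorial in a binomial coefficient,
    [a ^_ b * 'C(x, a) = x ^_ b * 'C(x - b, a - b)]. *)
Lemma falling_gen_binomial (a b : nat) x : (b <= a)%N ->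
  falling a%:R b * gen_binomial x a = falling x b * gen_binomial (x - b%:R) (a - b).
Proof.
move=> ba; rewrite /gen_binomial.
have -> : falling x a = falling x b * falling (x - b%:R) (a - b).
  by rewrite -falling_addl subnKC.
have -> : a`!%:R = falling a%:R b * (a - b)`!%:R :> R.
  by rewrite -!falling_fact natrB// -falling_addl subnKC.
have f0 : falling a%:R b != 0 :> R.
  apply/prodf_neq0 => i _; rewrite subr_eq0 eqr_nat gtn_eqF//.
  exact: leq_trans (ltn_ord i) ba.
field; rewrite f0 andbT pnatr_eq0 -lt0n fact_gt0//.
Qed.

End silvester.

Section lattice.
Context (R : numFieldType) (I : finType) (N : nat).
Implicit Types (X Y : I -> R) (a b : I -> nat).

(** The product [\prod_i 'C(X i, a i)]; with [X = N *: lambda], for barycentric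
    coordinates [lambda] and [a] of sum [N], it is the Lagrange basis function
    of degree [N] at the lattice point [a / N]. *)
Definition silvester a X : R := \prod_i gen_binomial (X i) (a i).

Definition lattice : pred {ffun I -> 'I_N.+1} :=
  [pred a : {ffun I -> 'I_N.+1} | \sum_i (a i : nat) == N]%N.

Definition lattice_sum (F : (I -> R) -> R) X : R :=
  \sum_(a | lattice a) F (fun i => (a i)%:R) * silvester (fun i => a i : nat) X.

(** The left-hand side is the coefficient of ['X^N] in
    [\prod_i \sum_(k <= N) k^_(b i) * 'C(X i, k) 'X^k], and Vandermonde's
    identity tells the coefficients of such products. *)
Lemma lattice_sum_falling b X : \sum_i X i = N%:R -> (\sum_i b i <= N)%N ->
  lattice_sum (fun Y => \prod_i falling (Y i) (b i)) X
  = \prod_i falling (X i) (b i).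
Proof.
move=> XN bN.
pose H i : {poly R} := \poly_(k < N.+1) (falling k%:R (b i) * gen_binomial (X i) k).
have coefH (s : seq I) k : (k <= N)%N -> (\prod_(i <- s) H i)`_k =
    (\prod_(i <- s) falling (X i) (b i)) *
    (if (\sum_(i <- s) b i <= k)%N then
      gen_binomial (\sum_(i <- s) X i - (\sum_(i <- s) b i)%:R) (k - \sum_(i <- s) b i)
     else 0).
  elim: s k => [|i s IHs] k kN.
    rewrite !big_nil coef1 mul1r subr0 subn0 /=.
    by case: k {kN} => [|k]; rewrite ?gen_binomial0// (@gen_binomial_lt _ 0).
  rewrite !big_cons coefM; set B := (\sum_(j <- s) b j)%N.
  pose g j := if (B <= k - j)%N
    then gen_binomial (\sum_(i <- s) X i - B%:R) (k - j - B) else 0.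
  rewrite (eq_bigr (fun j : 'I_k.+1 => falling j%:R (b i) * gen_binomial (X i) j *
    (\prod_(i <- s) falling (X i) (b i) * g j))); last first.
    move=> j _; have jk : (j <= k)%N by rewrite -ltnS.
    rewrite IHs; last by rewrite (leq_trans (leq_subr _ _)).
    by rewrite coef_poly ltnS (leq_trans jk).
  case: leqP => [bBk|kbB]; last first.
    rewrite mulr0 big1// => j _; rewrite /g; case: leqP => Bkj; last first.
      by rewrite !mulr0.
    by rewrite falling_lt ?mul0r//; have := ltn_ord j; lia.
  rewrite natrD (_ : _ - _ = (X i - (b i)%:R) + (\sum_(j <- s) X j - B%:R));
    last by ring.
  rewrite -vandermonde -(big_mkord xpredT (fun j => falling j%:R (b i) *
    gen_binomial (X i) j * (\prod_(i <- s) falling (X i) (b i) * g j))).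
  rewrite -(big_mkord xpredT (fun j => gen_binomial (X i - (b i)%:R) j *
    gen_binomial (\sum_(j <- s) X j - B%:R) (k - (b i + B) - j))).
  rewrite (@big_cat_nat _ _ _ (b i))//=; last by lia.
  rewrite [X in X + _]big_nat_cond big1 ?add0r; last first.
    by move=> j; rewrite andbT => /andP[_ jb]; rewrite falling_lt// !mul0r.
  rewrite (@big_cat_nat _ _ _ (k - B).+1)/=; [|lia|lia].
  rewrite [X in _ + X]big_nat_cond [X in _ + X]big1 ?addr0; last first.
    move=> j; rewrite andbT => /andP[kBj jk].
    by rewrite /g ifF ?mulr0//; lia.
  rewrite -{1}(add0n (b i)) big_addn mulr_sumr.
  rewrite (_ : (_.+1 - b i)%N = (k - (b i + B)).+1); last by lia.
  apply: eq_big_nat => j /andP[_ jk].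
  rewrite falling_gen_binomial ?leq_addl// addnK /g ifT; last by lia.
  rewrite (_ : (k - _ - B)%N = (k - (b i + B) - j)%N); last by lia.
  by ring.
have := coefH (index_enum I) N (leqnn N); rewrite bN XN -natrB// gen_binomial_nat mulr1.
move=> <-; rewrite /H; under [in RHS]eq_bigr do rewrite poly_def.
rewrite bigA_distr_bigA/= coef_sum /lattice_sum [RHS]big_mkcond/=.
rewrite [in LHS]big_mkcond/=; apply: eq_bigr => a _.
rewrite (eq_bigr (fun i => (falling (a i)%:R (b i) * gen_binomial (X i) (a i))%:P
  * 'X^(a i))) => [|i _]; last by rewrite mul_polyC.
rewrite big_split/= -rmorph_prod/= prodrXr coefCM coefXn big_split/= eq_sym.
by rewrite /lattice/=; case: eqP => _; rewrite ?mulr1 ?mulr0.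
Qed.

(** Products of at most [N] linear forms are combinations of products of falling
    factorials, because
    [Y i * falling (Y i) k = falling (Y i) k.+1 + k * falling (Y i) k]. *)
Lemma lattice_sum_prod (s : seq (I -> R)) X : \sum_i X i = N%:R -> (size s <= N)%N ->
  lattice_sum (fun Y => \prod_(l <- s) \sum_i l i * Y i) X
  = \prod_(l <- s) \sum_i l i * X i.
Proof.
move=> XN sN.
suff H b : (size s + \sum_i b i <= N)%N ->
    lattice_sum (fun Y => (\prod_(l <- s) \sum_i l i * Y i)
      * \prod_i falling (Y i) (b i)) X
    = (\prod_(l <- s) \sum_i l i * X i) * \prod_i falling (X i) (b i).
  have := H (fun=> 0%N); rewrite big1// addn0 => /(_ sN).
  rewrite [X in _ * X]big1 ?mulr1 => [<-|i _]; last by rewrite /falling big_ord0.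
  apply: eq_bigr => a _; rewrite [X in _ = _ * X * _]big1 ?mulr1// => i _.
  by rewrite /falling big_ord0.
elim: s {sN} b => [|l s IHs] b sN.
  rewrite big_nil mul1r -lattice_sum_falling//.
  by apply: eq_bigr => a _; rewrite big_nil mul1r.
pose b' i j := (b j + (i == j))%N.
have fallb' Y i : Y i * \prod_j falling (Y j) (b j) =
    \prod_j falling (Y j) (b' i j) + (b i)%:R * \prod_j falling (Y j) (b j).
  rewrite (bigD1 i)//= [X in _ = X + _](bigD1 i)//= /b' eqxx addn1 fallingS.
  rewrite [X in _ = _ * _ * X + _](eq_bigr (fun j => falling (Y j) (b j))).
    by ring.
  by move=> j ji; rewrite eq_sym (negPf ji) addn0.
have expand Y : (\prod_(m <- l :: s) \sum_i m i * Y i)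
      * \prod_i falling (Y i) (b i) =
    \sum_i l i * ((\prod_(m <- s) \sum_i m i * Y i) * \prod_j falling (Y j) (b' i j)
      + (b i)%:R * ((\prod_(m <- s) \sum_i m i * Y i) * \prod_j falling (Y j) (b j))).
  rewrite big_cons -mulrA mulr_suml; apply: eq_bigr => i _.
  transitivity (l i * ((\prod_(m <- s) \sum_i m i * Y i)
    * (Y i * \prod_j falling (Y j) (b j)))); first by ring.
  by rewrite fallb'; ring.
rewrite expand /lattice_sum.
under [LHS]eq_bigr => a _ do rewrite (expand (fun i => (a i)%:R)) mulr_suml.
rewrite exchange_big/=; apply: eq_bigr => i _.
rewrite -IHs; last first.
  rewrite /b' big_split/=.
  rewrite [X in (_ + (_ + X))%N](bigD1 i)//= eqxx [X in (1 + X)%N]big1 ?addn0.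
  2: by move=> j ji; rewrite eq_sym (negPf ji).
  by move: sN => /=; rewrite addnA addn1 addSn.
rewrite -IHs; last by move: sN => /=; rewrite addSn => /ltnW.
rewrite /lattice_sum mulr_sumr -big_split/= mulr_sumr.
by apply: eq_bigr => a _; ring.
Qed.

End lattice.

(** * Bounded Lipschitz functions *)

Section bddlip.
Context (R : realType).

(** A bound and a Lipschitz constant, kept apart because on an element of
    diameter [h] the second one is of the order of the first one divided by [h]. *)
Definition bddlip (V : normedModType R) (D : set V) (B L : R) (f : V -> R) :=
  (forall x, D x -> `|f x| <= B) /\
  (forall x y, D x -> D y -> `|f x - f y| <= L * `|x - y|).

Context (V : normedModType R) (D : set V).
Implicit Types (f g : V -> R) (B L : R).

Lemma bddlipW B L B' L' f : B <= B' -> L <= L' -> bddlip D B L f ->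
  bddlip D B' L' f.
Proof.
move=> BB LL [fB fL]; split=> [x Dx|x y Dx Dy]; first exact: le_trans (fB _ Dx) _.
by apply: le_trans (fL _ _ Dx Dy) _; rewrite ler_wpM2r.
Qed.

Lemma bddlipS (D' : set V) B L f : D' `<=` D -> bddlip D B L f -> bddlip D' B L f.
Proof. by move=> sD [fB fL]; split=> [x /sD|x y /sD Dx /sD]; [exact: fB|exact: fL]. Qed.

Lemma bddlip_eq B L f g : (forall x, D x -> f x = g x) -> bddlip D B L f ->
  bddlip D B L g.
Proof.
move=> fg [fB fL]; split=> [x Dx|x y Dx Dy]; first by rewrite -fg// fB.
by rewrite -!fg// fL.
Qed.

Lemma bddlip_cst c : bddlip D `|c| 0 (fun=> c).
Proof. by split=> // x y _ _; rewrite subrr normr0 mul0r. Qed.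

Lemma bddlipD B1 L1 B2 L2 f g : bddlip D B1 L1 f -> bddlip D B2 L2 g ->
  bddlip D (B1 + B2) (L1 + L2) (fun x => f x + g x).
Proof.
move=> [fB fL] [gB gL]; split=> [x Dx|x y Dx Dy].
  by rewrite (le_trans (ler_normD _ _))// lerD ?fB ?gB.
rewrite opprD addrACA (le_trans (ler_normD _ _))// mulrDl.
by rewrite lerD ?fL ?gL.
Qed.

Lemma bddlipN B L f : bddlip D B L f -> bddlip D B L (fun x => - f x).
Proof.
move=> [fB fL]; split=> [x Dx|x y Dx Dy]; first by rewrite normrN fB.
by rewrite -opprD normrN fL.
Qed.

Lemma bddlipB B1 L1 B2 L2 f g : bddlip D B1 L1 f -> bddlip D B2 L2 g ->
  bddlip D (B1 + B2) (L1 + L2) (fun x => f x - g x).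
Proof. by move=> Hf /bddlipN; exact: bddlipD. Qed.

Lemma bddlipM B1 L1 B2 L2 f g : bddlip D B1 L1 f -> bddlip D B2 L2 g ->
  bddlip D (B1 * B2) (B1 * L2 + B2 * L1) (fun x => f x * g x).
Proof.
move=> [fB fL] [gB gL]; split=> [x Dx|x y Dx Dy].
  by rewrite normrM ler_pM ?fB ?gB.
have -> : f x * g x - f y * g y = f x * (g x - g y) + g y * (f x - f y) by ring.
rewrite (le_trans (ler_normD _ _))// mulrDl !normrM -!mulrA.
by rewrite lerD// ler_pM ?fB ?gB ?fL ?gL.
Qed.

Lemma bddlip_sum (I : finType) (P : pred I) (B L : I -> R) (f : I -> V -> R) :
  (forall i, P i -> bddlip D (B i) (L i) (f i)) ->
  bddlip D (\sum_(i | P i) B i) (\sum_(i | P i) L i) (fun x => \sum_(i | P i) f i x).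
Proof.
move=> H; split=> [x Dx|x y Dx Dy].
  rewrite (le_trans (ler_norm_sum _ _ _))// ler_sum// => i Pi.
  by have [fB _] := H i Pi; exact: fB.
rewrite -sumrB (le_trans (ler_norm_sum _ _ _))// mulr_suml ler_sum// => i Pi.
by have [_ fL] := H i Pi; exact: fL.
Qed.

Lemma bddlip_comp (W : normedModType R) (E : set W) (g : W -> V) B L l f :
  0 <= L -> bddlip D B L f -> (forall x, E x -> D (g x)) ->
  (forall x y, E x -> E y -> `|g x - g y| <= l * `|x - y|) ->
  bddlip E B (L * l) (f \o g).
Proof.
move=> L0 [fB fL] gED gl; split=> [x Ex|x y Ex Ey] /=; first exact/fB/gED.
rewrite (le_trans (fL _ _ (gED _ Ex) (gED _ Ey)))// -mulrA ler_wpM2l//.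
exact: gl.
Qed.

(** Used for families that do not depend on the mesh, where the size of the
    constants is irrelevant. *)
Lemma ex_bddlip_prod (I : finType) (f : I -> V -> R) :
  (forall i, exists B L, bddlip D B L (f i)) ->
  exists B L, bddlip D B L (fun x => \prod_i f i x).
Proof.
move=> fBL; suff H (s : seq I) :
    exists B L, bddlip D B L (fun x => \prod_(i <- s) f i x) by exact: H.
elim: s => [|i s [B [L H]]].
  exists `|1|, 0; apply: (@bddlip_eq _ _ (fun=> 1)); last exact: bddlip_cst.
  by move=> x _; rewrite big_nil.
have [B' [L' H']] := fBL i.
exists (B' * B), (B' * L + B * L').
apply: bddlip_eq (bddlipM H' H) => x _; by rewrite big_cons.
Qed.

End bddlip.

Lemma ex_bddlip_poly (R : realType) (q : {poly R}) :
  exists B L, @bddlip R R^o [set x : R | `|x| <= 1] B L (fun x => q.[x]).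
Proof.
have idL : @bddlip R R^o [set x : R | `|x| <= 1] 1 1 id.
  by split=> // x y _ _; rewrite mul1r.
elim/poly_ind: q => [|q c [B [L H]]].
  exists `|0 : R|, 0; apply: (@bddlip_eq _ _ _ _ _ (fun=> 0)); last exact: bddlip_cst.
  by move=> x _; rewrite horner0.
have := bddlipD (bddlipM H idL) (@bddlip_cst R R^o _ c).
move: (B * 1 + _) (_ + 0) => B' L' H'; exists B', L'.
by apply: bddlip_eq H' => x _; rewrite !hornerE.
Qed.

Section rowvectors.
Context (R : realType) (n : nat).
Implicit Types (x y : 'rV[R]_n).

Lemma row_le_norm x i : `|x ord0 i| <= `|x|.
Proof.
rewrite [leRHS]/Num.Def.normr/= mx_normrE.
exact: (le_bigmax _ (fun ij : 'I_1 * 'I_n => `|x ij.1 ij.2|) (ord0, i)).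
Qed.

Lemma row_norm_le x (c : R) : 0 <= c -> (forall i, `|x ord0 i| <= c) -> `|x| <= c.
Proof.
move=> c0 xc; rewrite [leLHS]/Num.Def.normr/= mx_normrE bigmax_le// => -[i j] _ /=.
by rewrite ord1.
Qed.

End rowvectors.

(** * Polynomials on cubes *)

Section polynomials.
Context (R : realType).

Definition ev n (p : mpoly n R) (x : 'rV[R]_n) : R := meval (fun i => x ord0 i) p.

Definition point n (T : 'M[R]_(n.+1, n)) (l : 'I_n.+1 -> R) : 'rV[R]_n :=
  (\row_i l i) *m T.

Lemma evE n (p : mpoly n R) (x : 'rV[R]_n) :
  ev p x = \sum_(m <- msupp p) mcoeff m p * \prod_j x ord0 j ^+ m j.
Proof. exact: mevalE. Qed.

(** Exactness of Lagrange interpolation on a simplex: a monomial of degree at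
    most [N] is a product of that many linear forms in [N *: l]. *)
Lemma lattice_sum_mpoly n N (T : 'M[R]_(n.+1, n)) (p : mpoly n R) (l : 'I_n.+1 -> R) :
  (0 < N)%N -> (msize p <= N.+1)%N -> \sum_i l i = 1 ->
  lattice_sum N (fun Y => ev p (point T (fun i => Y i / N%:R))) (fun i => N%:R * l i)
  = ev p (point T l).
Proof.
move=> N0 pN l1; have N0' : N%:R != 0 :> R by rewrite pnatr_eq0 -lt0n.
have pointE Y j : point T (fun i => Y i / N%:R) ord0 j =
    \sum_i (T i j / N%:R) * Y i.
  by rewrite mxE; apply: eq_bigr => i _; rewrite mxE; ring.
have -> : point T l = point T (fun i => (N%:R * l i) / N%:R).
  congr (_ *m _); apply/rowP => i; rewrite !mxE; by field.
rewrite evE /lattice_sum; under eq_bigr do rewrite evE mulr_suml.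
rewrite exchange_big/= big_seq [RHS]big_seq; apply: eq_bigr => m mp.
pose s := flatten [seq nseq (m j) (fun i => T i j / N%:R) | j <- enum 'I_n].
have prodE Y : \prod_j point T (fun i => Y i / N%:R) ord0 j ^+ m j =
    \prod_(f <- s) \sum_i f i * Y i.
  rewrite /s big_flatten big_map -big_enum; apply: eq_bigr => j _ /=.
  by rewrite big_nseq iter_mulr_1 pointE.
have sN : (size s <= N)%N.
  rewrite size_flatten /shape -map_comp sumnE big_map -ltnS.
  rewrite (leq_trans _ pN)// (leq_ltn_trans _ (msize_mdeg_lt mp))// mdegE.
  by rewrite big_enum/=; apply: leq_sum => j _ /=; rewrite size_nseq.
rewrite prodE -(@lattice_sum_prod _ _ N)//; last by rewrite -mulr_sumr l1 mulr1.
rewrite /lattice_sum mulr_sumr; apply: eq_bigr => a _.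
by rewrite prodE mulrA.
Qed.

Definition grid_pos (s : R) r (b : nat) : R := s * b%:R / r%:R.

Definition grid n (s : R) r (b : {ffun 'I_n -> 'I_r}) : 'rV[R]_n :=
  \row_j grid_pos s r (b j).

Lemma grid_norm n s r (b : {ffun 'I_n -> 'I_r}) : 0 < s -> `|grid s b| <= s.
Proof.
move=> s0; apply: row_norm_le; first exact: ltW.
move=> i; rewrite mxE /grid_pos -mulrA normrM (gtr0_norm s0).
apply: ler_piMr; [exact: ltW|].
have r0 : 0 < r%:R :> R by rewrite ltr0n (leq_ltn_trans _ (ltn_ord (b i))).
rewrite ger0_norm; last by rewrite divr_ge0// ltW.
by rewrite ler_pdivrMr// mul1r ler_nat ltnW.
Qed.

(** Tensor product Lagrange interpolation. It is exact on monomials in each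
    variable, before and after the affine change of variables. *)
Lemma grid_interpolation n r (s : R) (p : mpoly n R) (y x : 'rV[R]_n) (h : R) :
  (0 < r)%N -> 0 < s -> (msize p <= r)%N ->
  ev p (y + h *: x) = \sum_(b : {ffun 'I_n -> 'I_r}) ev p (y + h *: grid s b) *
    \prod_j (val (tnth (qpoly.lagrange r (grid_pos s r)) (b j))).[x ord0 j].
Proof.
move=> r0 s0 pr; have r0' : r%:R != 0 :> R by rewrite pnatr_eq0 -lt0n.
have inj : injective (grid_pos s r).
  move=> a b /(congr1 (fun z => z * r%:R / s)); rewrite /grid_pos.
  have s0' : s != 0 by rewrite gt_eqF.
  rewrite !divfK// ![s * _]mulrC !mulfK// => /eqP.
  by rewrite eqr_nat => /eqP.
have lag (q : {poly R}) t : (size q <= r)%N -> q.[t] = \sum_(b < r)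
    q.[grid_pos s r b] * (val (tnth (qpoly.lagrange r (grid_pos s r)) b)).[t].
  move=> qr; rewrite {1}(qpoly.lagrange_gen r0 inj qr) horner_sum.
  by apply: eq_bigr => b _; rewrite hornerM hornerC.
rewrite evE; under [RHS]eq_bigr do rewrite evE mulr_suml.
rewrite exchange_big/= big_seq [RHS]big_seq; apply: eq_bigr => m mp.
under [RHS]eq_bigr do rewrite -mulrA -big_split/=.
rewrite -mulr_sumr; congr (_ * _).
pose q j : {poly R} := ((y ord0 j)%:P + h *: 'X) ^+ m j.
have qE j t : (q j).[t] = (y ord0 j + h * t) ^+ m j by rewrite /q !hornerE.
have qr j : (size (q j) <= r)%N.
  rewrite (leq_trans (size_poly_exp_leq _ _))//.
  have s2 : ((size ((y ord0 j)%:P + h *: 'X)%R).-1 <= 1)%N.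
    rewrite -subn1 leq_subLR (leq_trans (size_polyD _ _))// geq_max.
    rewrite (leq_trans (size_polyC_leq1 _))// (leq_trans (size_scale_leq _ _))//.
    by rewrite size_polyX.
  rewrite (leq_ltn_trans (leq_mul s2 (leqnn _)))// mul1n.
  rewrite (leq_trans _ pr)// (leq_ltn_trans _ (msize_mdeg_lt mp))// mdegE.
  by rewrite (bigD1 j)//= leq_addr.
rewrite (eq_bigr (fun j => \sum_(b < r) (q j).[grid_pos s r b] *
   (val (tnth (qpoly.lagrange r (grid_pos s r)) b)).[x ord0 j])); last first.
  by move=> j _; rewrite -lag// qE !mxE.
rewrite bigA_distr_bigA/=; apply: eq_bigr => b _; apply: eq_bigr => j _.
by rewrite qE !mxE.
Qed.

(** By [grid_interpolation] the polynomial is a combination of fixed functions with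
    its grid values as coefficients; by scaling, the constant depends neither on
    the cube nor on the polynomial. *)
Lemma grid_control n r (s : R) : (0 < r)%N -> 0 < s -> exists K : R, 0 < K /\
  forall (p : mpoly n R) (y : 'rV[R]_n) (h M : R),
    (msize p <= r)%N -> 0 < h ->
    (forall b : {ffun 'I_n -> 'I_r}, `|ev p (y + h *: grid s b)| <= M) ->
    bddlip [set x | `|x - y| <= h] (K * M) (K * M / h) (ev p).
Proof.
move=> r0 s0.
pose lag (b : {ffun 'I_n -> 'I_r}) (x : 'rV[R]_n) : R :=
  \prod_j (val (tnth (qpoly.lagrange r (grid_pos s r)) (b j))).[x ord0 j].
have /choice[BL HBL] : forall b, exists BL : R * R,
    bddlip [set x : 'rV[R]_n | `|x| <= 1] BL.1 BL.2 (lag b).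
  move=> b; suff [B [L H]] : exists B L,
      bddlip [set x : 'rV[R]_n | `|x| <= 1] B L (lag b) by exists (B, L).
  apply: ex_bddlip_prod => j.
  set q : {poly R} := val _; have [B [L H]] := ex_bddlip_poly q.
  exists `|B|, (`|L| * 1).
  have := @bddlip_comp R R^o [set x : R | `|x| <= 1] _ [set x : 'rV[R]_n | `|x| <= 1]
    (fun x => x ord0 j) `|B| `|L| 1 (fun t => q.[t]); apply => //.
  - by apply: bddlipW H; exact: ler_norm.
  - by move=> x /=; apply: le_trans; exact: row_le_norm.
  - move=> x z _ _; rewrite mul1r.
    by have := row_le_norm (x - z) j; rewrite !mxE.
pose K := 1 + \sum_b (`|(BL b).1| + `|(BL b).2|).
have K0 : 0 < K by rewrite ltr_pwDl// sumr_ge0.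
exists K; split=> // p y h M pr h0 pM.
have M0 : 0 <= M by exact: le_trans (normr_ge0 _) (pM [ffun=> Ordinal r0]).
have {}HBL b : bddlip [set x | `|x| <= 1] `|(BL b).1| `|(BL b).2| (lag b).
  by apply: bddlipW (HBL b); exact: ler_norm.
pose G x := \sum_b ev p (y + h *: grid s b) * lag b x.
have HG : bddlip [set x | `|x| <= 1] (K * M) (K * M) G.
  apply: bddlipW (bddlip_sum (fun b _ => bddlipM (bddlip_cst _ _) (HBL b))).
    rewrite /K mulrDl -[leLHS]add0r lerD ?mulr_ge0// mulr_suml ler_sum// => b _.
    rewrite mulrDl mulrC -[leLHS]addr0 lerD ?mulr_ge0//.
    by rewrite ler_wpM2l.
  rewrite /K mulrDl -[leLHS]add0r lerD ?mulr_ge0// mulr_suml ler_sum// => b _.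
  rewrite mulr0 addr0 mulrDl mulrC -[leLHS]add0r lerD ?mulr_ge0//.
  by rewrite ler_wpM2l.
have := @bddlip_comp _ _ _ _ [set x | `|x - y| <= h] (fun x => h^-1 *: (x - y))
  _ _ h^-1 _ _ HG.
have h0' : h != 0 by rewrite gt_eqF.
move=> HH; apply: bddlip_eq (HH _ _ _).
- move=> x _ /=; rewrite /G -(grid_interpolation y _ h r0 s0 pr) scalerA.
  by rewrite divff// scale1r addrC subrK.
- by rewrite mulr_ge0// ltW.
- by move=> x /=; rewrite normrZ gtr0_norm ?invr_gt0// mulrC ler_pdivrMr ?mul1r.
- move=> x z _ _; rewrite -scalerBr normrZ gtr0_norm ?invr_gt0//.
  by rewrite opprB addrA subrK.
Qed.

End polynomials.

(** * Differential calculus *)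

Section calculus.
Context (R : realType) (n : nat).
Implicit Types (x y z v w : 'rV[R]_n) (f : 'rV[R]_n -> R) (U : set 'rV[R]_n).

Lemma is_derive_cvg f x v (d : R) :
  is_derive x v f d <-> h^-1 *: (f (h *: v + x) - f x) @[h --> 0^'] --> d.
Proof.
split=> [[df <-]|H]; first exact: df.
by apply: DeriveDef; [apply/cvg_ex; exists d|exact/cvg_lim].
Qed.

Lemma is_derive_dirZ f x v (s d : R) :
  is_derive x v f d -> is_derive x (s *: v) f (s * d).
Proof.
have [->|s0] := eqVneq s 0.
  by move=> _; rewrite scale0r mul0r; exact: is_derive0.
move=> /is_derive_cvg H; apply/is_derive_cvg.
rewrite (_ : (fun h => _) =
    fun h => s *: ((h * s)^-1 *: (f ((h * s) *: v + x) - f x))); last first.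
  apply/funext => h; rewrite !scalerA invfM [h^-1 / s]mulrC mulrA divff// mul1r.
  by [].
rewrite -[s * d]/(s *: (d : R^o)); apply: cvgZl_tmp; apply: (cvg_comp _ _ _ H).
move=> A /= /nbhs_normP[e /= e0 eA].
apply/nbhs_normP; exists (e / `|s|); first by rewrite /= divr_gt0// normr_gt0.
move=> h /=; rewrite !sub0r !normrN ltr_pdivlMr ?normr_gt0// => hse h0.
by apply: eA; rewrite /= ?sub0r ?normrN ?normrM// mulf_neq0.
Qed.

Lemma is_derive_line f x w (t d : R) :
  is_derive (x + t *: w) w f d -> is_derive t 1 (fun t => f (x + t *: w)) d.
Proof.
move=> [df <-]; have E : (fun h : R => h^-1 *:
      (((fun t => f (x + t *: w)) \o shift t) (h *: 1) - f (x + t *: w))) =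
    (fun h => h^-1 *: ((f \o shift (x + t *: w)) (h *: w) - f (x + t *: w))).
  apply/funext => h /=; congr (_ *: (f _ - _)).
  by rewrite [h *: 1]mulr1 scalerDl addrCA addrA.
by apply: DeriveDef; rewrite /derivable /derive E.
Qed.

Lemma mvt_line f x w (df : R -> R) :
  (forall t : R, 0 <= t <= 1 -> is_derive (x + t *: w) w f (df t)) ->
  exists2 t, 0 <= t <= 1 & f (x + w) - f x = df t.
Proof.
move=> H.
have H1 (t : R) : 0 <= t <= 1 -> is_derive t 1 (fun t => f (x + t *: w)) (df t).
  by move=> /H; exact: is_derive_line.
have [|||t t01] := @MVT_segment R (fun t => f (x + t *: w)) df 0 1.
- exact: ler01.
- by move=> t; rewrite in_itv/= => /andP[t0 t1]; apply: H1; rewrite !ltW.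
- apply: derivable_within_continuous => t; rewrite in_itv/= => t01.
  by have [] := H1 t t01.
- rewrite subr0 mulr1 scale1r scale0r addr0 => E.
  by exists t => //; move: t01; rewrite in_itv.
Qed.

(** All directional derivatives are prescribed, not just the partial ones, for
    the sake of the mean value theorem on segments. *)
Definition has_gradient U f (Df : 'I_n -> 'rV[R]_n -> R) :=
  forall x v, U x -> is_derive x v f (\sum_i v ord0 i * Df i x).

Definition convex_set U :=
  forall x y (t : R), U x -> U y -> 0 <= t <= 1 -> U (x + t *: (y - x)).

Lemma gradient_le_lipschitz U f Df (L : R) : convex_set U ->
  has_gradient U f Df -> (forall i x, U x -> `|Df i x| <= L) ->
  forall x y, U x -> U y -> `|f x - f y| <= n%:R * L * `|x - y|.
Proof.
move=> cU gf DL x y Ux Uy.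
have [t t01] := @mvt_line f y (x - y)
  (fun t => \sum_i (x - y) ord0 i * Df i (y + t *: (x - y)))
  (fun t t01 => gf _ _ (cU _ _ _ Uy Ux t01)).
rewrite [y + (x - y)]addrC subrK => ->.
apply: (le_trans (ler_norm_sum _ _ _)).
apply: (@le_trans _ _ (\sum_(i < n) `|x - y| * L)); last first.
  by rewrite sumr_const card_ord -[leLHS]mulr_natl -mulrA [L * _]mulrC.
apply: ler_sum => i _; rewrite normrM ler_pM ?row_le_norm//.
exact/DL/cU.
Qed.

Lemma lipschitz_derive_le f x v (d L e : R) : 0 < e ->
  (forall y z, `|y - x| < e -> `|z - x| < e -> `|f y - f z| <= L * `|y - z|) ->
  is_derive x v f d -> `|d| <= L * `|v|.
Proof.
move=> e0 fL /is_derive_cvg /cvg_norm H.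
apply: cvgr_to_le H _; near=> h.
have h0 : h != 0 by near: h; exact: nbhs_dnbhs_neq.
rewrite normrZ normfV ler_pdivrMl ?normr_gt0//.
have -> : `|h| * (L * `|v|) = L * `|h *: v + x - x|.
  by rewrite addrK normrZ; ring.
apply: fL; last by rewrite subrr normr0.
rewrite addrK normrZ.
apply: (@le_lt_trans _ _ (`|h| * (`|v| + 1))); first by rewrite ler_wpM2l// lerDl.
rewrite -ltr_pdivlMr ?ltr_pwDr//.
by near: h; apply: dnbhs0_lt; rewrite divr_gt0// ltr_pwDr.
Unshelve. all: by end_near. Qed.

Lemma open_rowP U x : open U -> U x ->
  exists2 e : R, 0 < e & forall y, `|y - x| < e -> U y.
Proof.
move=> oU Ux; have /nbhs_normP[e /= e0 H] : nbhs x U by exact: open_nbhs_nbhs.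
by exists e => // y yx; apply: H; rewrite /= distrC.
Qed.

Lemma within_continuousP U f x : open U -> U x -> {within U, continuous f} ->
  forall e : R, 0 < e -> exists2 d, 0 < d &
    forall y, `|y - x| < d -> U y /\ `|f y - f x| < e.
Proof.
move=> oU Ux cf e e0.
have /continuous_open_subspace := oU; move=> /(_ _ f) cfU.
have := cf; rewrite cfU => /(_ x); rewrite inE => /(_ Ux).
move=> /cvgrPdist_lt /(_ _ e0) /nbhs_normP[d /= d0 H].
have [d' d'0 H'] := open_rowP oU Ux.
exists (Num.min d d') => [|y]; first by rewrite lt_min d0.
rewrite lt_min => /andP[yd yd']; split; first exact: H'.
by rewrite distrC; apply: H; rewrite /= distrC.
Qed.

(** Move along one coordinate axis after the other, and apply the mean value
    theorem to each step. *)
Lemma continuous_partials_gradient U f : open U ->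
  (forall i x, U x -> derivable f x (delta_mx ord0 i)) ->
  (forall i, {within U, continuous (partial i f)}) ->
  has_gradient U f (fun i => partial i f).
Proof.
move=> oU df cf x v Ux; apply/is_derive_cvg/cvgrPdist_le => /= e e0.
pose e' := e / (\sum_i `|v ord0 i| + 1).
have s0 : 0 < \sum_i `|v ord0 i| + 1 by rewrite ltr_wpDl// sumr_ge0.
have e'0 : 0 < e' by rewrite divr_gt0.
have /choice[dd Hdd] : forall i, exists d, 0 < d /\
    forall y, `|y - x| < d -> U y /\ `|partial i f y - partial i f x| < e'.
  by move=> i; have [d] := within_continuousP oU Ux (cf i) e'0; exists d.
have [D D0 HD] := open_rowP oU Ux.
pose d := \big[Num.min/D]_i dd i.
have d0 : 0 < d by apply: lt_bigmin => // i _; have [] := Hdd i.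
have dD i : d <= dd i by exact: bigmin_le.
have dU y : `|y - x| < d -> U y.
  by move=> yd; apply: HD; rewrite (lt_le_trans yd)// bigmin_le_id.
near=> h.
have h0 : h != 0 by near: h; exact: nbhs_dnbhs_neq.
have hv : `|h| * `|v| < d.
  apply: (@le_lt_trans _ _ (`|h| * (`|v| + 1))); first by rewrite ler_wpM2l// lerDl.
  rewrite -ltr_pdivlMr ?ltr_pwDr//.
  by near: h; apply: dnbhs0_lt; rewrite divr_gt0// ltr_pwDr.
pose V k : 'rV[R]_n := \row_j (if (j < k)%N then v ord0 j else 0).
pose p k := x + h *: V k.
have pS (k : 'I_n) : p k.+1 = p k + (h * v ord0 k) *: delta_mx ord0 k.
  rewrite /p -addrA -scalerA -scalerDr; congr (_ + _ *: _).
  apply/rowP => j; rewrite !mxE eqxx/= ltnS leq_eqVlt -val_eqE/=.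
  case: ltngtP => [jk|jk|/val_inj ->]; rewrite ?mulr0 ?addr0//.
  by rewrite mulr1 add0r.
have pd (k : 'I_n) (t : R) : 0 <= t <= 1 ->
    `|p k + t *: ((h * v ord0 k) *: delta_mx ord0 k) - x| < d.
  move=> /andP[t0 t1]; apply: le_lt_trans hv; rewrite /p [x + _]addrC addrAC addrK.
  rewrite scalerA [t * _]mulrCA -scalerA -scalerDr normrZ ler_wpM2l//.
  apply: row_norm_le => // j; rewrite !mxE eqxx/=.
  case: ltngtP => [jk|jk|jk].
  - by rewrite -val_eqE/= ltn_eqF// mulr0 addr0 row_le_norm.
  - by rewrite -val_eqE/= gtn_eqF// mulr0 addr0 normr0.
  - rewrite (val_inj jk) eqxx mulr1 add0r normrM ger0_norm//.
    by rewrite (le_trans _ (row_le_norm v k))// ler_piMl.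
have step (k : 'I_n) :
    `|f (p k.+1) - f (p k) - h * v ord0 k * partial k f x| <= `|h| * `|v ord0 k| * e'.
  pose w := (h * v ord0 k) *: (delta_mx ord0 k : 'rV[R]_n).
  have [|t t01] := @mvt_line f (p k) w
      (fun t => h * v ord0 k * partial k f (p k + t *: w)).
    move=> t t01; apply: is_derive_dirZ; apply: derivableP.
    exact/df/dU/pd.
  rewrite -pS => ->; rewrite -mulrBr normrM normrM ler_wpM2l ?mulr_ge0//.
  apply/ltW; have [_] := Hdd k; move=> /(_ (p k + t *: w)) [|_ //].
  exact: lt_le_trans (pd _ _ t01) (dD k).
have pn : p n = h *: v + x.
  rewrite addrC /p; congr (_ + _ *: _); apply/rowP => j.
  by rewrite mxE ltn_ord.
have p0 : p 0%N = x.
  rewrite /p (_ : V 0%N = 0) ?scaler0 ?addr0//.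
  by apply/rowP => j; rewrite !mxE.
rewrite -pn -[X in f _ - f X]p0 -(telescope_sumr (fun k => f (p k)))// big_mkord.
have -> : \sum_i v ord0 i * partial i f x -
    h^-1 *: \sum_(i < n) (f (p i.+1) - f (p i)) =
    - (h^-1 * \sum_(i < n) (f (p i.+1) - f (p i) - h * v ord0 i * partial i f x)).
  rewrite [in RHS]sumrB mulrBr opprB; congr (_ - _).
  by rewrite mulr_sumr; apply: eq_bigr => i _; rewrite !mulrA mulVf// mul1r.
rewrite normrN normrM normfV ler_pdivrMl ?normr_gt0//.
apply: le_trans (ler_norm_sum _ _ _) _.
apply: le_trans (ler_sum _ (fun i _ => step i)) _.
rewrite -mulr_suml -mulr_sumr -mulrA ler_wpM2l// /e' mulrCA ler_piMr ?ltW//.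
by rewrite ltr_pdivrMr// mul1r ltrDl.
Unshelve. all: by end_near. Qed.

End calculus.

Section gradients.
Context (R : realType) (n : nat).
Implicit Types (x y z v w : 'rV[R]_n) (f g : 'rV[R]_n -> R) (U : set 'rV[R]_n).

Lemma is_derive_translate f z a w (d : R) :
  is_derive (z + a) w f d -> is_derive z w (fun z => f (z + a)) d.
Proof.
move=> [df <-]; have E : (fun h : R => h^-1 *:
      (((fun z => f (z + a)) \o shift z) (h *: w) - f (z + a))) =
    (fun h => h^-1 *: ((f \o shift (z + a)) (h *: w) - f (z + a))).
  by apply/funext => h /=; rewrite addrA.
by apply: DeriveDef; rewrite /derivable /derive E.
Qed.

(** The second difference of [f] in two directions, expressed by the mean value
    theorem in one order of the directions. *)
Lemma second_difference f x (i j : 'I_n) (s : R) :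
  (forall t t' : R, 0 <= t <= s -> 0 <= t' <= s ->
    derivable f (x + t *: delta_mx ord0 i + t' *: delta_mx ord0 j) (delta_mx ord0 i) /\
    derivable (partial i f) (x + t *: delta_mx ord0 i + t' *: delta_mx ord0 j)
      (delta_mx ord0 j)) -> 0 <= s ->
  exists t t' : R, [/\ 0 <= t <= s, 0 <= t' <= s &
    f (x + s *: delta_mx ord0 i + s *: delta_mx ord0 j) - f (x + s *: delta_mx ord0 i)
      - (f (x + s *: delta_mx ord0 j) - f x) =
    s * s * partial j (partial i f) (x + t *: delta_mx ord0 i + t' *: delta_mx ord0 j)].
Proof.
set ei : 'rV[R]_n := delta_mx ord0 i; set ej : 'rV[R]_n := delta_mx ord0 j.
move=> H s0.
have ts (t : R) : 0 <= t <= 1 -> 0 <= t * s <= s.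
  by move=> /andP[t0 t1]; rewrite mulr_ge0// ler_piMl.
have z0 : 0 <= (0 : R) <= s by rewrite lexx.
have ss : 0 <= s <= s by rewrite s0 lexx.
have [|t t01 tE] := @mvt_line _ _ (fun z => f (z + s *: ej) - f z) x (s *: ei)
  (fun t => s * (partial i f (x + (t * s) *: ei + s *: ej)
              - partial i f (x + (t * s) *: ei))).
  move=> t t01; rewrite scalerA; apply: is_derive_dirZ.
  apply: is_deriveB.
    by apply/is_derive_translate/derivableP; have [] := H _ _ (ts _ t01) ss.
  apply: derivableP; have [] := H _ _ (ts _ t01) z0.
  by rewrite scale0r addr0.
have [|t' t'01 t'E] := @mvt_line _ _ (partial i f) (x + (t * s) *: ei) (s *: ej)
  (fun t' => s * partial j (partial i f) (x + (t * s) *: ei + (t' * s) *: ej)).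
  move=> t' t'01; rewrite scalerA; apply/is_derive_dirZ/derivableP.
  by have [] := H _ _ (ts _ t01) (ts _ t'01).
exists (t * s), (t' * s); split; rewrite ?ts//.
by rewrite tE t'E mulrA.
Qed.

(** The second difference is symmetric in the two directions, and its quotient by
    [s * s] is close to either mixed derivative at [x]. *)
Lemma schwarz U f (i j : 'I_n) x : open U -> U x ->
  (forall z, U z -> derivable f z (delta_mx ord0 i)) ->
  (forall z, U z -> derivable f z (delta_mx ord0 j)) ->
  (forall z, U z -> derivable (partial i f) z (delta_mx ord0 j)) ->
  (forall z, U z -> derivable (partial j f) z (delta_mx ord0 i)) ->
  {within U, continuous (partial j (partial i f))} ->
  {within U, continuous (partial i (partial j f))} ->
  partial j (partial i f) x = partial i (partial j f) x.
Proof.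
move=> oU Ux fi fj fij fji cij cji.
apply/eqP/negPn/negP => neq.
pose e := `|partial j (partial i f) x - partial i (partial j f) x| / 2.
have e0 : 0 < e by rewrite divr_gt0// normr_gt0 subr_eq0.
have [d1 d10 H1] := within_continuousP oU Ux cij e0.
have [d2 d20 H2] := within_continuousP oU Ux cji e0.
pose s := Num.min d1 d2 / 4.
have s0 : 0 < s by rewrite divr_gt0// lt_min d10.
have quarter (m : R) : 0 < m / 4 -> m / 4 + m / 4 < m by clear; lra.
have near_x (k l : 'I_n) (t t' : R) : 0 <= t <= s -> 0 <= t' <= s ->
    `|x + t *: delta_mx ord0 k + t' *: delta_mx ord0 l - x| < d1 /\
    `|x + t *: delta_mx ord0 k + t' *: delta_mx ord0 l - x| < d2.
  have nd (m : 'I_n) : `|delta_mx ord0 m : 'rV[R]_n| <= 1.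
    by apply: row_norm_le => // q; rewrite mxE eqxx/=; case: eqP; rewrite ?normr1 ?normr0.
  move=> /andP[t0 ts] /andP[t'0 t's].
  have -> : x + t *: delta_mx ord0 k + t' *: delta_mx ord0 l - x =
    t *: delta_mx ord0 k + t' *: delta_mx ord0 l.
    by rewrite -[x + _ + _]addrA [x + _]addrC addrK.
  suff : `|t *: delta_mx ord0 k + t' *: delta_mx ord0 l : 'rV[R]_n| < Num.min d1 d2.
    by rewrite lt_min => /andP.
  apply: (@le_lt_trans _ _ (s + s)); last exact: quarter.
  apply: (le_trans (ler_normD _ _)).
  by apply: lerD; rewrite normrZ ger0_norm//; apply: le_trans (ler_piMr _ (nd _)) _.
have [||t1 [t1' [t1s t1's E1]]] := @second_difference f x i j s.
- move=> t t' ts t's; have [/H1[Uz _] _] := near_x i j t t' ts t's.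
  by split; [exact: fi|exact: fij].
- exact: ltW.
have [||t2 [t2' [t2s t2's E2]]] := @second_difference f x j i s.
- move=> t t' ts t's; have [/H1[Uz _] _] := near_x j i t t' ts t's.
  by split; [exact: fj|exact: fji].
- exact: ltW.
have [/H1[_ L1] _] := near_x i j _ _ t1s t1's.
have [_ /H2[_ L2]] := near_x j i _ _ t2s t2's.
have E : partial j (partial i f) (x + t1 *: delta_mx ord0 i + t1' *: delta_mx ord0 j) =
    partial i (partial j f) (x + t2 *: delta_mx ord0 j + t2' *: delta_mx ord0 i).
  have ss0 : s * s != 0 by rewrite mulf_neq0// gt_eqF.
  have swap (a b c d : R) : a - b - (c - d) = a - c - (b - d) by clear; ring.
  apply: (mulfI ss0); apply: etrans (esym E1) _; apply: etrans _ E2.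
  rewrite swap; congr (f _ - _ - _); exact: addrAC.
move: L2; rewrite -E => L2.
have tri (a b c : R) : `|a - b| <= `|c - a| + `|c - b|.
  by rewrite [`|c - a|]distrC; apply: le_trans (ler_normD _ _); rewrite addrA subrK.
have := le_lt_trans (tri _ _ _) (ltrD L1 L2).
by rewrite /e -splitr ltxx.
Qed.

Lemma is_derive_coord x v (i : 'I_n) :
  is_derive x v (fun x => x ord0 i) (v ord0 i).
Proof.
apply/is_derive_cvg; apply: (@cvg_trans _ ((fun=> v ord0 i : R) @ 0^')).
  2: exact: cvg_cst.
apply: near_eq_cvg; near=> h.
have h0 : h != 0 by near: h; exact: nbhs_dnbhs_neq.
by rewrite !mxE addrK [_ *: _]mulrA mulVf// mul1r.
Unshelve. all: by end_near. Qed.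

(** The polynomials with this property form a subring that contains the constants
    and the variables. *)
Lemma is_derive_ev (p : mpoly n R) x v :
  is_derive x v (ev p) (\sum_i v ord0 i * ev (mderiv i p) x).
Proof.
pose P (p : mpoly n R) := is_derive x v (ev p) (\sum_i v ord0 i * ev (mderiv i p) x).
have PC c : P (mpolyC n c).
  rewrite /P (_ : ev _ = fun=> c); last by apply/funext => z; rewrite /ev mevalC.
  rewrite big1 => [|i _]; first exact: is_derive_cst.
  by rewrite mderivC /ev meval0 mulr0.
have PD q r : P q -> P r -> P (q + r).
  move=> Pq Pr; rewrite /P (_ : ev _ = ev q + ev r); last first.
    by apply/funext => z; rewrite /ev mevalD.
  rewrite (_ : \sum_i _ = \sum_i v ord0 i * ev (mderiv i q) x +
    \sum_i v ord0 i * ev (mderiv i r) x); first exact: is_deriveD.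
  rewrite -big_split; apply: eq_bigr => i _ /=.
  by rewrite mderivD /ev mevalD mulrDr.
have PM q r : P q -> P r -> P (q * r).
  move=> Pq Pr; rewrite /P (_ : ev _ = ev q * ev r); last first.
    by apply/funext => z; rewrite /ev mevalM.
  rewrite (_ : \sum_i _ = ev q x *: (\sum_i v ord0 i * ev (mderiv i r) x) +
    ev r x *: \sum_i v ord0 i * ev (mderiv i q) x); first exact: is_deriveM.
  rewrite ![_ *: _]mulr_sumr -big_split; apply: eq_bigr => i _ /=.
  by rewrite mderivM /ev mevalD !mevalM; ring.
have PX i : P (mpolyX R (mnm1 i)).
  rewrite /P (_ : ev _ = fun z => z ord0 i); last first.
    by apply/funext => z; rewrite /ev mevalXU.
  apply: is_derive_eq (is_derive_coord x v i) _.
  rewrite (bigD1 i)//= [X in _ + X]big1 ?addr0 => [|j ji].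
    rewrite mderivX mnm1E eqxx scale1r (_ : mnm_sub _ _ = mnm0) ?mpolyX0.
      by rewrite /ev meval1 mulr1.
    by apply/mnmP => k; rewrite mnmBE mnm0E subnn.
  by rewrite mderivX mnm1E eq_sym (negPf ji) scale0r /ev meval0 mulr0.
suff PXm m : P (mpolyX R m).
  elim/mpolyind: p => [|c m q _ _ Pq]; first by rewrite -mpolyC0; exact: PC.
  by apply: PD Pq; rewrite -mul_mpolyC; exact: PM.
rewrite mpolyXE_id; elim/big_rec: _ => [|i q _ Pq]; first exact: PC.
apply: (PM _ _ _ Pq); elim: (m i) => [|k IHk]; first by rewrite expr0; exact: PC.
by rewrite exprS; exact: PM.
Qed.

Lemma has_gradient_ev U (p : mpoly n R) :
  has_gradient U (ev p) (fun i => ev (mderiv i p)).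
Proof. by move=> x v _; exact: is_derive_ev. Qed.

Lemma has_gradient_partial U f Df : has_gradient U f Df ->
  forall x i, U x -> partial i f x = Df i x.
Proof.
move=> Hf x i Ux; rewrite /partial; have [_ ->] := Hf x (delta_mx ord0 i) Ux.
rewrite (bigD1 i)//= mxE !eqxx mul1r big1 ?addr0// => j ji.
by rewrite mxE eqxx (negPf ji) mul0r.
Qed.

Lemma gradient_le_of_lipschitz U f Df (L : R) x i : open U -> has_gradient U f Df ->
  (forall y z, U y -> U z -> `|f y - f z| <= L * `|y - z|) -> U x -> `|Df i x| <= L.
Proof.
move=> oU Hf fL Ux; have [e e0 eU] := open_rowP oU Ux.
have := Hf x (delta_mx ord0 i) Ux.
rewrite (bigD1 i)//= mxE !eqxx mul1r big1 ?addr0 => [H|j ji]; last first.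
  by rewrite mxE eqxx (negPf ji) mul0r.
have nd : `|delta_mx ord0 i : 'rV[R]_n| = 1.
  apply/eqP; rewrite eq_le row_norm_le//=; last first.
    by move=> j; rewrite mxE eqxx/=; case: eqP; rewrite ?normr1 ?normr0.
  by have := row_le_norm (delta_mx ord0 i : 'rV[R]_n) i; rewrite mxE !eqxx normr1.
have := @lipschitz_derive_le _ _ _ _ _ _ L e e0 _ H; rewrite nd mulr1; apply.
by move=> y z /eU Uy /eU Uz; exact: fL.
Qed.

Lemma has_gradientM U f g Df Dg : has_gradient U f Df -> has_gradient U g Dg ->
  has_gradient U (fun x => f x * g x) (fun i x => f x * Dg i x + g x * Df i x).
Proof.
move=> Hf Hg x v Ux; apply: is_derive_eq (is_deriveM (Hf x v Ux) (Hg x v Ux)) _.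
rewrite ![_ *: _]mulr_sumr -big_split; apply: eq_bigr => i _ /=; ring.
Qed.

Lemma has_gradientB U f g Df Dg : has_gradient U f Df -> has_gradient U g Dg ->
  has_gradient U (fun x => f x - g x) (fun i x => Df i x - Dg i x).
Proof.
move=> Hf Hg x v Ux; apply: is_derive_eq (is_deriveB (Hf x v Ux) (Hg x v Ux)) _.
by rewrite -sumrB; apply: eq_bigr => i _; rewrite mulrBr.
Qed.

Lemma has_gradientS U V f Df : U `<=` V -> has_gradient V f Df -> has_gradient U f Df.
Proof. by move=> UV Hf x v /UV; exact: Hf. Qed.

Lemma has_gradient_eq U f g Df : open U -> (forall x, U x -> f x = g x) ->
  has_gradient U f Df -> has_gradient U g Df.
Proof.
move=> oU fg Hf x v Ux; apply: near_eq_is_derive (Hf x v Ux).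
by near=> z; apply: fg; near: z; exact: open_nbhs_nbhs.
Unshelve. all: by end_near. Qed.

Lemma smooth_partial2 U f i j x : open U -> smooth U f -> U x ->
  partial j (partial i f) x = partial i (partial j f) x.
Proof.
move=> oU sf Ux.
have d0 k z : U z -> derivable f z (delta_mx ord0 k).
  by move=> Uz; have [_] := sf [::]; exact.
have d1 k l z : U z -> derivable (partial k f) z (delta_mx ord0 l).
  by move=> Uz; have [_] := sf [:: k]; exact.
apply: (schwarz oU Ux) => //.
- exact: d0.
- exact: d0.
- exact: d1.
- exact: d1.
- by have [] := sf [:: j; i].
- by have [] := sf [:: i; j].
Qed.

Lemma smooth_gradient U f (s : seq 'I_n) : open U -> smooth U f ->
  has_gradient U (partials s f) (fun i => partial i (partials s f)).
Proof.
move=> oU sf; apply: continuous_partials_gradient => //.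
- by move=> i x Ux; have [_] := sf s; exact.
- by move=> i; have [] := sf (i :: s).
Qed.

End gradients.

(** * Lebesgue measure of cubes and norms *)

Section measure_cubes.
Context (R : realType).

Definition cube n (y : 'rV[R]_n) (s : R) : set 'rV[R]_n := [set x | `|x - y| <= s].

Lemma cubeP n (y : 'rV[R]_n) (s : R) : 0 <= s ->
  cube y s = [set x | forall i, `|x ord0 i - y ord0 i| <= s].
Proof.
move=> s0; apply/seteqP; split=> x /= xs.
  by move=> i; have := row_le_norm (x - y) i; rewrite !mxE => /le_trans; apply.
by apply: row_norm_le => // i; rewrite !mxE.
Qed.

Lemma measurable_coord n (i : 'I_n) (D : set R) : measurable D ->
  measurable [set x : 'rV[R]_n | D (x ord0 i)].
Proof.
move=> mD; apply: sub_sigma_algebra; rewrite -bigcup_seq; exists i => /=.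
  by rewrite mem_index_enum.
by exists D => //; rewrite setTI.
Qed.

Lemma measurable_cube n (y : 'rV[R]_n) (s : R) : 0 <= s -> measurable (cube y s).
Proof.
move=> s0; have -> : cube y s = \bigcap_(i in [set: 'I_n])
    [set x : 'rV[R]_n | `[y ord0 i - s, y ord0 i + s]%classic (x ord0 i)].
  rewrite cubeP//; apply/seteqP; split=> [x H i _|x H i /=].
    by rewrite /= in_itv/= -ler_distl.
  by have := H i Logic.I; rewrite /= in_itv/= -ler_distl.
apply: fin_bigcap_measurable => // i _; apply: measurable_coord.
exact: measurable_itv.
Qed.

Lemma lebesgue_cube n (y : 'rV[R]_n) (s : R) : 0 <= s ->
  lebesgue_rV R n (cube y s) = ((s *+ 2) ^+ n)%:E.
Proof.
move=> s0; elim: n y => [|n IHn] y.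
  by rewrite /= /dirac indicE mem_set// cubeP//= => -[].
rewrite [LHS]/= /rV_prod /pushforward.
pose y' : 'rV[R]_n := \row_i y ord0 (lift ord0 i).
rewrite (_ : _ @^-1` _ = cube y' s `*`
    [set` `[y ord0 ord0 - s, y ord0 ord0 + s]%R]); last first.
  rewrite !cubeP//; apply/seteqP; split=> -[x t] /=.
    move=> H; split.
      move=> i; have := H (lift ord0 i); rewrite !mxE.
      case: splitP => [j /= ij|k /= ik]; first by have := ltn_ord j; rewrite -ij.
      have -> : k = i by apply: ord_inj; move: ik => /= [].
      by [].
    have := H ord0; rewrite !mxE; case: splitP => [j /= _|k //].
    by rewrite !mxE in_itv/= -ler_distl.
  move=> [H1 H2] i; rewrite !mxE; case: splitP => [j ij|k ik].
    rewrite !mxE (_ : i = ord0); last by apply: val_inj; rewrite /= ij ord1.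
    by move: H2; rewrite /= in_itv/= -ler_distl.
  have := H1 k; rewrite !mxE (_ : i = lift ord0 k)//.
  exact: val_inj.
apply: etrans (product_measure1E _ _ _ _) _.
- exact: measurable_cube.
- exact: measurable_itv.
rewrite IHn; apply: etrans (congr1 (mule _) (lebesgue_measure_itv _)) _.
rewrite /= lte_fin.
case: ltP => [_|].
  rewrite -EFinD -EFinM; congr (_%:E).
  rewrite exprSr; congr (_ * _).
  by rewrite mulr2n; clear; ring.
move=> H; suff -> : s = 0 by rewrite mule0 mul0rn exprS mul0r.
by apply/eqP; rewrite eq_le s0 andbT; move: H; move: (y _ _) => a; clear; lra.
Qed.

Context (n : nat).
Implicit Types (D : set 'rV[R]_n) (f g u : 'rV[R]_n -> R).
Local Open Scope ereal_scope.

(** The integral of a nonnegative function is a supremum over the simple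
    functions below it, hence monotone without measurability. *)
Lemma ge0_integral_le (f g : 'rV[R]_n -> \bar R) :
  (forall x, 0 <= f x) -> (forall x, f x <= g x) ->
  \int[lebesgue_rV R n]_x f x <= \int[lebesgue_rV R n]_x g x.
Proof.
move=> f0 fg; have g0 x : 0 <= g x by exact: le_trans (f0 x) (fg x).
rewrite !ge0_integralTE//; apply: le_ereal_sup => _ [h hf <-].
by exists h => // x; exact: le_trans (hf x) (fg x).
Qed.

Lemma integral_cst_cube (y : 'rV[R]_n) (s c : R) : (0 <= s)%R ->
  \int[lebesgue_rV R n]_x ((fun=> c) \_ (cube y s) x)%:E = (c * (s *+ 2) ^+ n)%:E.
Proof.
move=> s0; have mc := measurable_cube y s0.
transitivity (\int[lebesgue_rV R n]_(x in cube y s) (cst c%:E x)).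
  rewrite [RHS]integral_mkcond; apply: eq_integral => x _ /=.
  by rewrite !patchE; case: ifP.
by rewrite integral_cst// lebesgue_cube// EFinM.
Qed.

Lemma H1norm_le D (y : 'rV[R]_n) (s K : R) u : (0 <= s)%R -> (0 <= K)%R ->
  D `<=` cube y s ->
  (forall x, D x -> u x ^+ 2 + enorm (gradient u x) ^+ 2 <= K ^+ 2)%R ->
  H1norm D u <= (K * Num.sqrt ((s *+ 2) ^+ n))%:E.
Proof.
move=> s0 K0 Ds uK; rewrite /H1norm.
apply: (@le_trans _ _ ((K ^+ 2 * (s *+ 2) ^+ n)%:E `^ 2^-1)).
  apply: gt0_ler_poweR.
  - by rewrite invr_ge0.
  - rewrite in_itv/= leey andbT integral_ge0// => x _.
    by rewrite lee_fin addr_ge0// sqr_ge0.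
  - by rewrite in_itv/= leey andbT lee_fin mulr_ge0 ?sqr_ge0// exprn_ge0// mulrn_wge0.
  rewrite -(integral_cst_cube y)// integral_mkcond; apply: ge0_integral_le => x.
    rewrite patchE; case: ifP => // _.
    by rewrite lee_fin addr_ge0// sqr_ge0.
  rewrite !patchE; case: ifPn => [/set_mem Dx|_].
    by rewrite ifT ?lee_fin ?uK//; apply/mem_set/Ds.
  by case: ifP => _; rewrite lee_fin// sqr_ge0.
rewrite poweR_EFin powR12_sqrt; last first.
  by rewrite mulr_ge0 ?sqr_ge0// exprn_ge0// mulrn_wge0.
by rewrite sqrtrM ?sqr_ge0// sqrtr_sqr ger0_norm.
Qed.

Lemma L2norm_ge D (y : 'rV[R]_n) (s m : R) u : (0 <= s)%R -> (0 <= m)%R ->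
  cube y s `<=` D -> (forall x, cube y s x -> m <= `|u x|)%R ->
  (m * Num.sqrt ((s *+ 2) ^+ n))%:E <= L2norm D u.
Proof.
move=> s0 m0 sD um; rewrite /L2norm /Lpnorm unlock.
have s2 : (0 <= (s *+ 2) ^+ n)%R by rewrite exprn_ge0// mulrn_wge0.
have -> : ((m * Num.sqrt ((s *+ 2) ^+ n))%:E = (m ^+ 2 * (s *+ 2) ^+ n)%:E `^ 2^-1).
  rewrite poweR_EFin powR12_sqrt ?mulr_ge0 ?sqr_ge0//.
  by rewrite sqrtrM ?sqr_ge0// sqrtr_sqr ger0_norm.
apply: gt0_ler_poweR.
- by rewrite invr_ge0.
- by rewrite in_itv/= leey andbT lee_fin mulr_ge0 ?sqr_ge0.
- by rewrite in_itv/= leey andbT integral_ge0// => x _; exact: poweR_ge0.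
rewrite -(integral_cst_cube y)//; apply: ge0_integral_le => x.
  by rewrite patchE; case: ifP => _; rewrite lee_fin// sqr_ge0.
rewrite patchE; case: ifPn => [/set_mem cx|_]; last exact: poweR_ge0.
rewrite /= patchE ifT; last exact/mem_set/sD.
rewrite lee_fin powR_mulrn// lerXn2r ?nnegrE//; exact: um.
Qed.

(** By continuity, an exceptional point would come with a cube of them, which has
    positive measure. *)
Lemma Lpnorm_oo_le D u (c : R) : open D -> {within D, continuous u} ->
  Lpnorm +oo D u <= c%:E -> forall x, D x -> (`|u x| <= c)%R.
Proof.
move=> oD cu; rewrite /Lpnorm unlock; case: ifPn => [_|]; last first.
  have := @lebesgue_cube n 0%R 1%R ler01 => L /negP; case.
  apply: (@lt_le_trans _ _ (lebesgue_rV R n (cube 0%R 1%R))).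
    by rewrite L lte_fin exprn_gt0.
  by apply: le_measure => //; rewrite inE//; exact: measurable_cube.
move=> /ess_sup_inf.ess_supP H x Dx; rewrite leNgt; apply/negP => cux.
have e0 : (0 < `|u x| - c)%R by rewrite subr_gt0.
have [d d0 Hd] := within_continuousP oD Dx cu e0.
have d20 : (0 < d / 2)%R by rewrite divr_gt0.
have [B [mB B0 sB]] := H.
have : lebesgue_rV R n (cube x (d / 2)%R) <= 0.
  rewrite -B0; apply: le_measure; rewrite ?inE//.
    by apply: measurable_cube; exact: ltW.
  move=> z zd; apply: sB => Hz.
  have [|Dz uzx] := Hd z.
    by apply: le_lt_trans zd _; rewrite [ltRHS]splitr ltrDl.
  move: Hz => /=; rewrite patchE ifT ?inE// lee_fin leNgt => /negP; apply.
  have L1 := lerB_dist (u x) (u z); move: L1 uzx; rewrite distrC.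
  by move: `|_ - _|%R `|u x|%R `|u z|%R => p q t; clear; lra.
rewrite lebesgue_cube; last exact: ltW.
rewrite leNgt lte_fin => /negP; apply.
by rewrite exprn_gt0// pmulrn_lgt0.
Qed.

End measure_cubes.

(** * Barycentric coordinates *)

Section barycentric.
Context (R : realType) (n : nat).
Implicit Types (T : 'M[R]_(n.+1, n)) (x y z w : 'rV[R]_n) (l : 'I_n.+1 -> R)
  (S : {set 'I_n.+1}).

(** It maps barycentric coordinates [l] to the homogeneous coordinates
    [(1, l *m T)] of a point. *)
Definition homog T : 'M[R]_(n.+1) := row_mx (const_mx 1 : 'cV[R]_n.+1) T.

(** With [c = 1], the barycentric coordinates of the point [w]; with [c = 0],
    their linear part, applied to the vector [w]. *)
Definition bary_lin T w (c : R) (i : 'I_n.+1) : R :=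
  ((row_mx (const_mx c : 'rV[R]_1) w : 'rV[R]_n.+1) *m invmx (homog T)) ord0 i.

Definition bary T x : 'I_n.+1 -> R := bary_lin T x 1.

Lemma pointE T l j : point T l ord0 j = \sum_i l i * T i j.
Proof. by rewrite mxE; apply: eq_bigr => i _; rewrite mxE. Qed.

Lemma homog_unit T : affinely_independent T -> homog T \in unitmx.
Proof.
move=> aT; rewrite -row_free_unit; apply: inj_row_free => v.
move=> vT; have : v *m row_mx (const_mx 1 : 'cV[R]_n.+1) T = row_mx 0 0.
  by rewrite row_mx0; exact: vT.
rewrite mul_mx_row => /eq_row_mx[v1 vT0]; apply: aT => //.
move/rowP: v1 => /(_ ord0); rewrite !mxE => v1; rewrite -[RHS]v1.
by apply: eq_bigr => i _; rewrite mxE mulr1.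
Qed.

Lemma homogE T (v : 'rV[R]_n.+1) :
  v *m homog T = row_mx (const_mx (\sum_i v ord0 i) : 'rV[R]_1) (v *m T) :> 'rV[R]_n.+1.
Proof.
transitivity (row_mx (v *m (const_mx 1 : 'cV[R]_n.+1)) (v *m T) : 'rV[R]_n.+1).
  exact: (@mul_mx_row R 1 n.+1 1 n v (const_mx 1) T).
have -> : v *m (const_mx 1 : 'cV[R]_n.+1) = const_mx (\sum_i v ord0 i) => //.
apply/rowP => i; rewrite !mxE.
by apply: eq_bigr => k _; rewrite mxE mulr1.
Qed.

Section affinely_independent.
Context (T : 'M[R]_(n.+1, n)) (aT : affinely_independent T).

Lemma bary_lin_spec w c : \sum_i bary_lin T w c i = c /\ point T (bary_lin T w c) = w.
Proof.
have : ((row_mx (const_mx c : 'rV[R]_1) w : 'rV[R]_n.+1) *m invmx (homog T)) *m homog T =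
    row_mx (const_mx c : 'rV[R]_1) w :> 'rV[R]_n.+1.
  by rewrite mulmxKV// homog_unit.
rewrite homogE => H; have [/rowP/(_ ord0) + wE] := @eq_row_mx R 1 1 n _ _ _ _ H.
rewrite !mxE => sE.
split=> //; rewrite -[RHS]wE; congr (_ *m _).
by apply/rowP => i; rewrite mxE.
Qed.

Lemma bary_sum x : \sum_i bary T x i = 1.
Proof. by have [] := bary_lin_spec x 1. Qed.

Lemma point_bary x : point T (bary T x) = x.
Proof. by have [] := bary_lin_spec x 1. Qed.

Lemma point_inj l l' : \sum_i l i = \sum_i l' i -> point T l = point T l' -> l =1 l'.
Proof.
move=> sE pE i; have : (\row_i (l i - l' i)) = 0 :> 'rV_n.+1.
  apply: aT; first by under eq_bigr do rewrite mxE; rewrite sumrB sE subrr.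
  apply/rowP => j; rewrite !mxE; under eq_bigr do rewrite mxE mulrBl.
  by rewrite sumrB -!pointE pE subrr.
by move=> /rowP/(_ i); rewrite !mxE => /eqP; rewrite subr_eq0 => /eqP.
Qed.

Lemma bary_point l : \sum_i l i = 1 -> bary T (point T l) =1 l.
Proof. by move=> l1; apply: point_inj; rewrite ?bary_sum ?point_bary. Qed.

Lemma baryB x y i : bary T x i - bary T y i = bary_lin T (x - y) 0 i.
Proof.
rewrite /bary /bary_lin -[in RHS](subrr (1 : R)).
rewrite (_ : row_mx (const_mx (1 - 1)) _ =
   row_mx (const_mx 1 : 'rV[R]_1) x - row_mx (const_mx 1 : 'rV[R]_1) y).
  by rewrite mulmxBl !mxE.
by rewrite opp_row_mx add_row_mx; congr row_mx; apply/rowP => j; rewrite !mxE.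
Qed.

Lemma bary_linZ w (t : R) i : bary_lin T (t *: w) 0 i = t * bary_lin T w 0 i.
Proof.
rewrite /bary_lin (_ : row_mx (const_mx 0) _ = t *: row_mx (const_mx 0 : 'rV[R]_1) w).
  by rewrite -scalemxAl mxE.
by rewrite scale_row_mx; congr row_mx; apply/rowP => j; rewrite !mxE mulr0.
Qed.

Lemma bary_segment x y (t : R) i :
  bary T (x + t *: (y - x)) i = bary T x i + t * (bary T y i - bary T x i).
Proof.
have H : bary T (x + t *: (y - x)) i - bary T x i = t * (bary T y i - bary T x i).
  by rewrite !baryB -bary_linZ [x + _]addrC addrK.
by rewrite -H [RHS]addrC subrK.
Qed.

Lemma bary_vertex i j : bary T (row i T) j = (i == j)%:R.
Proof.
have -> : row i T = point T (fun j => (i == j)%:R).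
  apply/rowP => k; rewrite pointE mxE (bigD1 i)//= eqxx mul1r big1 ?addr0//.
  by move=> j' ji; rewrite eq_sym (negPf ji) mul0r.
apply: bary_point; rewrite (bigD1 i)//= eqxx big1 ?addr0// => j' ji.
by rewrite eq_sym (negPf ji).
Qed.

Lemma faceP S x : face T S x <->
  (forall i, 0 <= bary T x i) /\ (forall i, i \notin S -> bary T x i = 0).
Proof.
split=> [[l [l0 lS l1 ->]]|[b0 bS]].
  have E : bary T (l *m T) =1 l ord0.
    move=> i; rewrite -(bary_point l1); congr bary.
    by congr (_ *m _); apply/rowP => j; rewrite mxE.
  by split=> i; rewrite E//; exact: lS.
exists (\row_i bary T x i); split.
- by move=> i; rewrite mxE.
- by move=> i iS; rewrite mxE bS.
- by under eq_bigr do rewrite mxE; exact: bary_sum.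
- by rewrite -{1}(point_bary x).
Qed.

Lemma simplexP x : simplex T x <-> forall i, 0 <= bary T x i.
Proof.
split=> [/faceP[]//|b0]; apply/faceP; split=> // i.
by rewrite finset.in_setT.
Qed.

Lemma bary_le1 x i : simplex T x -> bary T x i <= 1.
Proof.
move=> /simplexP b0; rewrite -(bary_sum x) (bigD1 i)//= lerDl.
by apply: sumr_ge0.
Qed.

Lemma face_sub_simplex S : face T S `<=` simplex T.
Proof. by move=> x /faceP[b0 _]; exact/simplexP. Qed.

Lemma face_segment S x y (t : R) : face T S x -> face T S y -> 0 <= t <= 1 ->
  face T S (x + t *: (y - x)).
Proof.
move=> /faceP[x0 xS] /faceP[y0 yS] /andP[t0 t1]; apply/faceP; split=> i.
  rewrite bary_segment.
  have -> : bary T x i + t * (bary T y i - bary T x i) =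
    (1 - t) * bary T x i + t * bary T y i by ring.
  by rewrite addr_ge0 ?mulr_ge0 ?subr_ge0.
by move=> iS; rewrite bary_segment xS// yS// subrr mulr0 addr0.
Qed.

Lemma ex_bary_lipschitz : exists2 K : R, 0 < K &
  forall x y i, `|bary T x i - bary T y i| <= K * `|x - y|.
Proof.
pose M := \sum_(i < n.+1) \sum_(j < n.+1) `|invmx (homog T) j i|.
have M0 : 0 <= M by apply: sumr_ge0 => i _; exact: sumr_ge0.
exists (M + 1) => [|x y i]; first by rewrite ltr_wpDl.
apply: (@le_trans _ _ (M * `|x - y|)); last by rewrite ler_wpM2r// lerDl.
rewrite baryB /bary_lin mxE (le_trans (ler_norm_sum _ _ _))//.
have Mi : \sum_(j < n.+1) `|invmx (homog T) j i| <= M.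
  by rewrite /M [leRHS](bigD1 i)//= lerDl sumr_ge0// => k _; exact: sumr_ge0.
apply: (@le_trans _ _ ((\sum_(j < n.+1) `|invmx (homog T) j i|) * `|x - y|)).
  2: by rewrite ler_wpM2r.
rewrite mulr_suml; apply: ler_sum => j _; rewrite normrM mulrC ler_wpM2l//.
rewrite mxE; case: splitP => k _; first by rewrite mxE normr0.
exact: row_le_norm.
Qed.

(** A coordinate is affine and varies by at most 1 over an inscribed cube. *)
Lemma bary_lipschitz y (s : R) : 0 < s -> cube y s `<=` simplex T ->
  forall x z i, `|bary T x i - bary T z i| <= s^-1 * `|x - z|.
Proof.
move=> s0 ys x z i; rewrite baryB.
have [->|xz] := eqVneq (x - z) 0.
  by rewrite -[0 in X in X <= _](scale0r (0 : 'rV[R]_n)) bary_linZ mul0r !normr0 mulr0.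
have xz0 : 0 < `|x - z| by rewrite normr_gt0.
have c0 : simplex T y by apply: ys; rewrite /cube /= subrr normr0 ltW.
pose v := (s / `|x - z|) *: (x - z).
have cv : simplex T (y + v).
  apply: ys; rewrite /cube /= addrC addKr normrZ ger0_norm; last first.
    by rewrite divr_ge0// ltW.
  by rewrite divfK// gt_eqF.
have : `|bary T (y + v) i - bary T y i| <= 1.
  have /simplexP/(_ i) a0 := c0; have /simplexP/(_ i) b0 := cv.
  have a1 := bary_le1 i c0; have b1 := bary_le1 i cv.
  by rewrite ler_norml; apply/andP; split;
    move: (bary T y i) (bary T (y + v) i) a0 b0 a1 b1 => p q; clear; lra.
rewrite baryB [y + v]addrC addrK /v bary_linZ normrM ger0_norm; last first.
  by rewrite divr_ge0// ltW.
by rewrite mulrAC ler_pdivrMr// mul1r mulrC -ler_pdivlMr// mulrC.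
Qed.

Lemma simplex_interiorP x : (simplex T)° x <-> forall i, 0 < bary T x i.
Proof.
split=> [/nbhs_normP[e /= e0 eT] i|b0].
  have xT : simplex T x by apply: eT => /=; rewrite subrr normr0.
  have /simplexP xb := xT; rewrite lt_neqAle xb andbT; apply/eqP => xi.
  have v0 : 0 < `|x - row i T| + 1 by rewrite ltr_wpDl.
  pose t : R := e / (`|x - row i T| + 1) / 2.
  have t0 : 0 < t by rewrite !divr_gt0.
  have : simplex T (x + (- t) *: (row i T - x)).
    apply: eT => /=; rewrite opprD addrA subrr sub0r normrN normrZ normrN.
    rewrite gtr0_norm// distrC /t mulrAC ltr_pdivrMr// mulrAC ltr_pdivrMr//.
    rewrite -mulrA ltr_pM2l// mulr_natl mulr2n -[ltLHS]addr0 ltr_leD//.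
    by rewrite ltrDl.
  move=> /simplexP/(_ i); rewrite bary_segment -xi bary_vertex eqxx subr0 mulr1 add0r.
  by rewrite oppr_ge0 leNgt t0.
have [K K0 HK] := ex_bary_lipschitz.
pose m := \big[Num.min/1]_i bary T x i.
have m0 : 0 < m by apply: lt_bigmin.
suff : \forall z \near x, simplex T z by [].
apply/nbhs_normP; exists (m / K); first by rewrite /= divr_gt0.
move=> z /=; rewrite ltr_pdivlMr// mulrC => zx; apply/simplexP => i.
have := le_lt_trans (HK x z i) zx => H.
have mi : m <= bary T x i by exact: bigmin_le.
move: H; rewrite ltr_norml => /andP[_] /lt_le_trans/(_ mi).
by rewrite ltrBlDr ltrDl => /ltW.
Qed.

Lemma simplex_interior_segment x y (t : R) : simplex T x -> (simplex T)° y ->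
  0 < t <= 1 -> (simplex T)° (x + t *: (y - x)).
Proof.
move=> /simplexP x0 /simplex_interiorP y0 /andP[t0 t1].
apply/simplex_interiorP => i; rewrite bary_segment.
have -> : bary T x i + t * (bary T y i - bary T x i) =
  (1 - t) * bary T x i + t * bary T y i by ring.
by rewrite ltr_wpDl ?mulr_gt0// mulr_ge0// subr_ge0.
Qed.

Lemma convex_simplex_interior : convex_set (simplex T)°.
Proof.
move=> x y t xT yT /andP[t0 t1]; have [->|tn0] := eqVneq t 0.
  by rewrite scale0r addr0.
apply: simplex_interior_segment => //; first exact: interior_subset.
by rewrite lt_neqAle eq_sym tn0 t0.
Qed.

Lemma open_nsimplex z : ~ simplex T z ->
  exists2 e : R, 0 < e & forall x, `|x - z| < e -> ~ simplex T x.
Proof.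
move=> zT; have [i bi] : exists i, bary T z i < 0.
  apply: contrapT => H; apply: zT; apply/simplexP => i; rewrite leNgt.
  by apply/negP => bi; apply: H; exists i.
have [K K0 HK] := ex_bary_lipschitz.
exists (- bary T z i / K) => [|x]; first by rewrite divr_gt0// oppr_gt0.
rewrite ltr_pdivlMr// mulrC => xz /simplexP/(_ i).
have := le_lt_trans (HK x z i) xz; rewrite ltr_norml => /andP[_].
rewrite ltrBlDr addNr ltNge => /negP H b0; exact: H.
Qed.

End affinely_independent.

Lemma bary_change T T' z k : affinely_independent T -> affinely_independent T' ->
  bary T' z k = \sum_i bary T z i * bary T' (row i T) k.
Proof.
move=> aT aT'; move: k; apply: (point_inj aT').
  rewrite bary_sum// exchange_big/= -(bary_sum aT z).
  by apply: eq_bigr => i _; rewrite -mulr_sumr bary_sum// mulr1.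
rewrite point_bary// -{1}(point_bary aT z).
apply/rowP => k; rewrite !pointE.
under [RHS]eq_bigr do rewrite mulr_suml.
rewrite exchange_big/=; apply: eq_bigr => i _.
under eq_bigr do rewrite -mulrA.
by rewrite -mulr_sumr -pointE point_bary// mxE.
Qed.

(** The vertices of a simplex are its extreme points, so that a face determines its
    vertices. *)
Lemma face_vertex T T' S S' i : affinely_independent T -> affinely_independent T' ->
  face T S = face T' S' -> i \in S -> exists2 j, j \in S' & row i T = row j T'.
Proof.
move=> aT aT' FF iS.
have : face T S (row i T).
  apply/(faceP aT); split=> k; rewrite bary_vertex//.
  by move=> kS; case: eqP => // ik; rewrite -ik iS in kS.
rewrite FF => /(faceP aT')[l0 lS]; set l := bary T' _ in l0 lS.
have [j lj] : exists j, 0 < l j.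
  apply: contrapT => H; have := bary_sum aT' (row i T); rewrite big1.
    by move=> /eqP; rewrite eq_sym oner_eq0.
  move=> j _; apply/eqP; rewrite eq_le l0 andbT leNgt; apply/negP => lj; apply: H.
  by exists j.
have jS : j \in S' by apply: contraPT lj => /lS ->; rewrite ltxx.
exists j => //.
have vT k : k \in S' -> face T S (row k T').
  move=> kS; rewrite FF; apply/(faceP aT'); split=> m; rewrite bary_vertex//.
  by move=> mS; case: eqP => // km; rewrite -km kS in mS.
have E k := bary_change (row i T) k aT' aT.
(* [1 = \sum_m l m * bary T (row m T') i] is a mean of numbers at most 1. *)
have Eij : bary T (row j T') i = 1.
  apply/eqP; rewrite eq_le bary_le1//=; last exact/face_sub_simplex/vT.
  rewrite leNgt; apply/negP => lt1.
  have := E i; rewrite bary_vertex// eqxx.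
  rewrite -(bary_sum aT' (row i T)) => /eqP; rewrite eq_sym; apply/negP.
  rewrite lt_eqF// -/l (bigD1 j)//= [ltRHS](bigD1 j)//= ltr_leD//.
    by rewrite -[ltRHS]mulr1 ltr_pM2l.
  apply: ler_sum => m _; have [mS|mS] := boolP (m \in S'); last first.
    by rewrite lS// mul0r.
  rewrite -[leRHS]mulr1 ler_wpM2l// bary_le1//; exact/face_sub_simplex/vT.
have /(face_sub_simplex aT) jT := vT _ jS.
rewrite -(point_bary aT (row i T)) -(point_bary aT (row j T')).
congr (_ *m _); apply/rowP => k; rewrite !mxE bary_vertex//.
have [<-|ik] := eqVneq i k; first by rewrite Eij.
have /simplexP b0 := jT; have := bary_sum aT (row j T').
rewrite (bigD1 i)//= Eij => /eqP; rewrite -subr_eq0 addrAC subrr add0r.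
rewrite psumr_eq0; last by move=> m _; exact: b0.
by move=> /allP/(_ k); rewrite mem_index_enum eq_sym ik/= => /(_ isT)/eqP.
Qed.

End barycentric.

(** * Size and position of the elements of a mesh *)

Section sizes.
Context (R : realType) (n : nat).
Implicit Types (T : 'M[R]_(n.+1, n)) (v x y z : 'rV[R]_n) (A : set 'rV[R]_n).

Lemma norm_le_enorm v : `|v| <= enorm v.
Proof.
apply: row_norm_le; first exact: sqrtr_ge0.
move=> i; rewrite -sqrtr_sqr ler_sqrt; last by apply: sumr_ge0 => j _; exact: sqr_ge0.
by rewrite (bigD1 i)//= lerDl sumr_ge0// => j _; exact: sqr_ge0.
Qed.

Lemma enorm_le v (c : R) : 0 <= c -> (forall i, `|v ord0 i| <= c) ->
  enorm v <= n%:R * c.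
Proof.
move=> c0 vc; have nc0 : 0 <= n%:R * c by rewrite mulr_ge0.
rewrite -(ger0_norm nc0) -sqrtr_sqr ler_sqrt ?sqr_ge0//.
apply: (@le_trans _ _ (\sum_(i < n) c ^+ 2)).
  apply: ler_sum => i _; rewrite -real_normK ?num_real//.
  by rewrite lerXn2r ?nnegrE.
rewrite sumr_const card_ord -[leLHS]mulr_natl exprMn ler_wpM2r ?sqr_ge0//.
by case: n => [|m]; rewrite ?expr0n// expr2 ler_peMl// ler1n.
Qed.

Lemma simplex_bounded T x : simplex T x -> `|x| <= \sum_i `|row i T|.
Proof.
move=> [l [l0 _ l1 ->]]; rewrite mulmx_sum_row (le_trans (ler_norm_sum _ _ _))//.
apply: ler_sum => i _; rewrite normrZ ger0_norm// ler_piMl//.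
by rewrite -l1 (bigD1 i)//= lerDl sumr_ge0.
Qed.

Lemma diameter_ge A (B : R) x y : 0 <= B -> (forall z, A z -> `|z| <= B) ->
  A x -> A y -> enorm (x - y) <= diameter A.
Proof.
move=> B0 AB Ax Ay; apply: sup_ubound; last by exists x => //; exists y.
exists (n%:R * (B + B)) => _ [z Az [w Aw <-]].
apply: enorm_le => [|i]; first exact: addr_ge0.
rewrite (le_trans (row_le_norm _ _))// (le_trans (ler_normB _ _))//.
by rewrite lerD ?AB.
Qed.

Lemma diameter_le A (B : R) : 0 <= B -> A !=set0 -> (forall z, A z -> `|z| <= B) ->
  diameter A <= n%:R * (B + B).
Proof.
move=> B0 [x Ax] AB; apply: sup_le_ub; first by exists (enorm (x - x)), x => //; exists x.
move=> _ [z Az [w Aw <-]].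
apply: enorm_le => [|i]; first exact: addr_ge0.
rewrite (le_trans (row_le_norm _ _))// (le_trans (ler_normB _ _))//.
by rewrite lerD ?AB.
Qed.

Lemma simplex_diameter T x y : simplex T x -> simplex T y -> `|x - y| <= hmesh T.
Proof.
move=> xT yT; apply: le_trans (norm_le_enorm _) _.
apply: diameter_ge xT yT; last exact: simplex_bounded.
by apply: sumr_ge0.
Qed.

Lemma simplex_nonempty T : simplex T !=set0.
Proof.
exists (row ord0 T), (delta_mx ord0 ord0); split.
- by move=> i; rewrite mxE; case: eqP => _; rewrite ?andbF.
- by move=> i; rewrite finset.in_setT.
- rewrite (bigD1 ord0)//= mxE !eqxx big1 ?addr0// => i i0.
  by rewrite mxE (negPf i0) andbF.
- by rewrite rowE.
Qed.

Lemma inscribed_cube T (c : R) y : (0 < n)%N -> 0 < c -> 0 < hmesh T ->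
  eball y (c * hmesh T / 2) `<=` simplex T ->
  cube y (c / (4 * n%:R) * hmesh T) `<=` simplex T.
Proof.
move=> n0 c0 h0 yT x; rewrite cubeP/=; last first.
  by rewrite mulr_ge0 ?divr_ge0 ?mulr_ge0// ltW.
move=> xy; apply: yT => /=.
apply: le_lt_trans (@enorm_le _ (c / (4 * n%:R) * hmesh T) _ _) _.
- by rewrite mulr_ge0 ?divr_ge0 ?mulr_ge0// ltW.
- by move=> i; rewrite !mxE.
have n0' : n%:R != 0 :> R by rewrite pnatr_eq0 -lt0n.
have -> : n%:R * (c / (4 * n%:R) * hmesh T) = c * hmesh T / 4 by field.
by rewrite ltr_pM2l ?mulr_gt0// ltf_pV2 ?posrE// ltr_nat.
Qed.

End sizes.

Section meshes.
Context (R : realType) (n : nat) (Omega : set 'rV[R]_n) (Th : seq 'M[R]_(n.+1, n)).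
Hypothesis oO : open Omega.
Hypothesis ThO : simplicial_decomposition Omega Th.
Implicit Types (T : 'M[R]_(n.+1, n)) (x z : 'rV[R]_n) (S : {set 'I_n.+1}).

Lemma simplex_closure T x : T \in Th -> simplex T x -> closure Omega x.
Proof.
case: ThO => _ cE _ _ TTh xT; rewrite cE.
by exists T.
Qed.

Lemma frontierE x : frontier Omega x <-> closure Omega x /\ ~ Omega x.
Proof.
have O : Omega° = Omega by exact/interior_id.
by rewrite /frontier O; split.
Qed.

(** If a relative interior point [z] of a face lies on the frontier, it lies in a
    face [F] of another element [T'] that is contained in the frontier. The two
    elements meet in a face of the first one, so that [T'] contains the vertices
    of the first face; being a proper convex combination of them, [z] can only
    lie in [F] if they do. *)
Lemma face_frontier T S z : T \in Th ->
  (forall i, (0 < bary T z i) = (i \in S)) -> simplex T z -> ~ Omega z ->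
  face T S `<=` frontier Omega.
Proof.
case: ThO => aff _ conf fr TTh zS zT zO.
have aT := aff _ TTh.
have [|T' [T'Th [S' [zS' S'fr]]]] := fr z.
  by apply/frontierE; split=> //; exact: simplex_closure zT.
have aT' := aff _ T'Th.
have [S1 [S1' [TT FF]]] := conf _ _ TTh T'Th.
have zS1 : face T S1 z by rewrite -TT; split=> //; exact: face_sub_simplex zS'.
have vT' i : i \in S -> simplex T' (row i T).
  move=> iS; suff : (simplex T `&` simplex T') (row i T) by case.
  rewrite TT; apply/(faceP aT); split=> k; rewrite bary_vertex// => kS1.
  case: eqP => // ik; move: kS1; rewrite -ik; apply: contraNeq => _.
  have /(faceP aT)[_ b0] := zS1; apply: contraLR iS => /b0 bi.
  by rewrite -zS bi ltxx.
have bzE k := bary_change z k aT aT'.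
have b0 i : 0 <= bary T z i by move/(simplexP aT): zT.
have bS i : i \notin S -> bary T z i = 0.
  by move=> iS; apply/eqP; rewrite eq_le b0 andbT leNgt zS.
have vS' i k : i \in S -> k \notin S' -> bary T' (row i T) k = 0.
  move=> iS kS'; have /(faceP aT')[_ /(_ _ kS')] := zS'.
  rewrite bzE => /eqP; rewrite psumr_eq0; last first.
    move=> j _; have [jS|/bS ->] := boolP (j \in S); last by rewrite mul0r.
    by rewrite mulr_ge0//; have /(simplexP aT') := vT' _ jS.
  move=> /allP/(_ i); rewrite mem_index_enum => /(_ isT)/=.
  by rewrite mulf_eq0 gt_eqF ?zS//= => /eqP.
move=> w wS; apply: S'fr; apply/(faceP aT').
have /(faceP aT)[w0 wS0] := wS.
have bwE k := bary_change w k aT aT'.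
split=> [k|k kS']; rewrite bwE.
  apply: sumr_ge0 => i _; have [iS|/wS0 ->] := boolP (i \in S); last by rewrite mul0r.
  by rewrite mulr_ge0//; have /(simplexP aT') := vT' _ iS.
rewrite big1// => i _; have [iS|/wS0 ->] := boolP (i \in S); last by rewrite mul0r.
by rewrite vS' ?mulr0.
Qed.

(** Otherwise the whole element would be contained in the frontier, but points of
    the domain are arbitrarily close to each point of the element. *)
Lemma simplex_interior_sub T : T \in Th -> (simplex T)° `<=` Omega.
Proof.
move=> TTh x xT; apply: contrapT => xO.
have aT : affinely_independent T by case: ThO => aff _ _ _; exact: aff.
have xT' := interior_subset xT.
have fT : face T [set: 'I_n.+1]%SET `<=` frontier Omega.
  apply: face_frontier xT' xO => // i; rewrite finset.in_setT.
  by have /(simplex_interiorP aT) -> := xT.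
have /frontierE[cx _] := fT _ xT'.
have [z [Oz /interior_subset zT]] := cx _ (nbhs_interior xT).
by have /frontierE[] := fT _ zT.
Qed.

(** The contrapositive of [face_frontier], in the form needed for a face shared by
    two elements. *)
Lemma face_interior_sub T S x z : T \in Th -> face T S x -> Omega x ->
  simplex T z -> (forall i, (0 < bary T z i) = (i \in S)) -> Omega z.
Proof.
move=> TTh xS Ox zT zS; apply: contrapT => zO.
by have /frontierE[] := face_frontier TTh zS zT zO xS.
Qed.

End meshes.

(** * Lipschitz extension *)

Section mcshane.
Context (R : realType) (V : normedModType R).
Implicit Types (A : set V) (f : V -> R).

(** McShane's extension of a Lipschitz function on [A] to the whole space. *)
Definition mcshane A f (L : R) (z : V) : R := inf [set f y + L * `|z - y| | y in A].

Lemma mcshaneP A f (L : R) : 0 <= L -> A !=set0 ->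
  (forall x y, A x -> A y -> `|f x - f y| <= L * `|x - y|) ->
  (forall z, A z -> mcshane A f L z = f z) /\
  (forall z w, `|mcshane A f L z - mcshane A f L w| <= L * `|z - w|).
Proof.
move=> L0 [y0 Ay0] fL.
pose E z := [set f y + L * `|z - y| | y in A].
have En0 z : E z !=set0 by exists (f y0 + L * `|z - y0|), y0.
have lbE z x : A x -> lbound (E z) (f x - L * `|z - x|).
  move=> Ax _ [y Ay <-].
  have h1 : f x - f y <= L * `|x - y| by exact: le_trans (ler_norm _) (fL _ _ Ax Ay).
  have h2 : L * `|x - y| <= L * `|z - x| + L * `|z - y|.
    by rewrite -mulrDr ler_wpM2l// [`|z - x|]distrC ler_distD.
  have := le_trans h1 h2; rewrite lerBlDr => h3.
  by rewrite lerBlDr (le_trans h3)// [leLHS]addrC [L * _ + _]addrC addrA.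
have infE z : has_inf (E z).
  by split; [exact: En0|exists (f y0 - L * `|z - y0|); exact: lbE].
have infD z w : mcshane A f L z <= mcshane A f L w + L * `|z - w|.
  rewrite -lerBlDr; apply: lb_le_inf; first exact: En0.
  move=> _ [y Ay <-]; rewrite lerBlDr.
  apply: (@le_trans _ _ (f y + L * `|z - y|)).
    by apply: ge_inf; [exact: (infE z).2|exists y].
  rewrite -addrA lerD2l -mulrDr ler_wpM2l// [leRHS]addrC.
  exact: ler_distD.
split=> [z Az|z w].
  apply/eqP; rewrite eq_le; apply/andP; split.
    apply: ge_inf; first exact: (infE z).2.
    by exists z => //; rewrite subrr normr0 mulr0 addr0.
  apply: lb_le_inf; first exact: En0.
  by have := lbE z z Az; rewrite subrr normr0 mulr0 subr0.
rewrite ler_distl lerBlDr infD andbT distrC.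
exact: infD.
Qed.

End mcshane.

(** * Lagrange interpolation on a simplex *)

Section interpolation.
Context (R : realType) (n : nat).
Implicit Types (T : 'M[R]_(n.+1, n)) (x y : 'rV[R]_n) (p q : mpoly n R)
  (g : 'rV[R]_n -> R) (S : {set 'I_n.+1}).

Definition node N T (a : {ffun 'I_n.+1 -> 'I_N.+1}) : 'rV[R]_n :=
  point T (fun i => (a i)%:R / N%:R).

Definition bary_mpoly T (i : 'I_n.+1) : mpoly n R :=
  mpolyC n (invmx (homog T) ord0 i) +
  \sum_j invmx (homog T) (lift ord0 j) i *: mpolyX R (mnm1 j).

Definition gen_binomial_mpoly q k : mpoly n R :=
  k`!%:R^-1 *: \prod_(m < k) (q - mpolyC n m%:R).

(** The Lagrange interpolant of degree [N], in Silvester's form. *)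
Definition interp N T g : mpoly n R :=
  \sum_(a : {ffun 'I_n.+1 -> 'I_N.+1} | lattice a) g (node T a) *:
    \prod_i gen_binomial_mpoly (N%:R *: bary_mpoly T i) (a i).

Lemma ev_bary_mpoly T i x : ev (bary_mpoly T i) x = bary T x i.
Proof.
rewrite /ev mevalD mevalC raddf_sum/= /bary /bary_lin mxE big_ord_recl.
congr (_ + _).
  rewrite mxE; case: splitP => j; first by rewrite mxE mul1r.
  by move=> /= /eqP.
apply: eq_bigr => j _; rewrite mevalZ mevalXU mulrC; congr (_ * _).
rewrite mxE; case: splitP => k /=; first by rewrite ord1.
by move=> [jk]; congr (x _ _); exact: ord_inj.
Qed.

Lemma ev_gbin_mpoly q k x : ev (gen_binomial_mpoly q k) x = gen_binomial (ev q x) k.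
Proof.
rewrite /ev mevalZ mulrC /gen_binomial; congr (_ * _).
rewrite rmorph_prod/=; apply: eq_bigr => m _.
by rewrite mevalB mevalC.
Qed.

Lemma ev_interp N T g x : ev (interp N T g) x =
  \sum_(a : {ffun 'I_n.+1 -> 'I_N.+1} | lattice a) g (node T a) *
    silvester (fun i => a i : nat) (fun i => N%:R * bary T x i).
Proof.
rewrite /ev raddf_sum/=; apply: eq_bigr => a _; rewrite mevalZ; congr (_ * _).
rewrite rmorph_prod/=; apply: eq_bigr => i _.
by rewrite -[LHS]/(ev _ _) ev_gbin_mpoly /ev mevalZ -/(ev _ _) ev_bary_mpoly.
Qed.

Lemma msizeM_deg p q (a b : nat) : (msize p <= a.+1)%N -> (msize q <= b.+1)%N ->
  (msize (p * q)%R <= (a + b).+1)%N.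
Proof.
move=> pa qb; have [->|p0] := eqVneq p 0; first by rewrite mul0r msize0.
have [->|q0] := eqVneq q 0; first by rewrite mulr0 msize0.
by rewrite msizeM//; move: (msize p) (msize q) pa qb => c d; lia.
Qed.

Lemma msize_prod_deg (I : Type) (s : seq I) (F : I -> mpoly n R) (a : I -> nat) :
  (forall i, msize (F i) <= (a i).+1)%N ->
  (msize (\prod_(i <- s) F i) <= (\sum_(i <- s) a i).+1)%N.
Proof.
move=> Fa; elim: s => [|i s IHs]; first by rewrite !big_nil msize1.
by rewrite !big_cons; exact: msizeM_deg.
Qed.

Lemma msize_sum_deg (I : Type) (s : seq I) (P : pred I) (F : I -> mpoly n R) k :
  (forall i, P i -> msize (F i) <= k)%N -> (msize (\sum_(i <- s | P i) F i)%R <= k)%N.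
Proof.
move=> Fk; elim/big_rec: _ => [|i p Pi pk]; first by rewrite msize0.
by rewrite (leq_trans (msizeD_le _ _))// geq_max Fk.
Qed.

Lemma msize_interp N T g : (msize (interp N T g) <= N.+1)%N.
Proof.
apply: msize_sum_deg => a /eqP aN; apply: leq_trans (msizeZ_le _ _) _.
rewrite -[X in (_ <= X.+1)%N]aN; apply: msize_prod_deg => i.
apply: leq_trans (msizeZ_le _ _) _.
rewrite -[X in (_ <= X.+1)%N](card_ord (a i)) -sum1_card.
apply: msize_prod_deg => m.
rewrite (leq_trans (msizeD_le _ _))// geq_max; apply/andP; split; last first.
  by rewrite msizeN msizeC; case: (_ == _).
apply: leq_trans (msizeZ_le _ _) _.
rewrite (leq_trans (msizeD_le _ _))// geq_max; apply/andP; split.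
  by rewrite msizeC; case: (_ == _).
apply: msize_sum_deg => j _; apply: leq_trans (msizeZ_le _ _) _.
by rewrite msizeX mdeg1.
Qed.

Lemma interp_exact N T p x : affinely_independent T -> (0 < N)%N ->
  (msize p <= N.+1)%N -> ev (interp N T (ev p)) x = ev p x.
Proof.
move=> aT N0 pN; rewrite ev_interp -{2}(point_bary aT x).
by rewrite -(lattice_sum_mpoly T N0 pN (bary_sum aT x)).
Qed.

Lemma silvester_node N (a b : {ffun 'I_n.+1 -> 'I_N.+1}) :
  lattice a -> lattice b ->
  silvester (fun i => a i : nat) (fun i => (b i)%:R) = (a == b)%:R :> R.
Proof.
move=> /eqP aN /eqP bN; have [->|ab] := eqVneq a b.
  by rewrite /silvester big1// => i _; rewrite gen_binomial_nat.
have [i bai] : exists i, (b i < a i)%N.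
  apply: contrapT => H; move/eqP: ab; apply; apply/ffunP => i; apply: val_inj => /=.
  have leab j : (a j <= b j)%N.
    by rewrite leqNgt; apply/negP => ?; apply: H; exists j.
  apply/eqP; rewrite eqn_leq leab /= leqNgt; apply/negP => abi.
  have : (\sum_i a i < \sum_i b i)%N.
    rewrite (bigD1 i)//= [ltnRHS](bigD1 i)//= -addSn leq_add//.
    by apply: leq_sum => j _.
  by rewrite aN bN ltnn.
by rewrite /silvester (bigD1 i)//= gen_binomial_lt// mul0r.
Qed.

Lemma interp_node N T g (b : {ffun 'I_n.+1 -> 'I_N.+1}) :
  affinely_independent T -> (0 < N)%N -> lattice b ->
  ev (interp N T g) (node T b) = g (node T b).
Proof.
move=> aT N0 bN; have N0' : N%:R != 0 :> R by rewrite pnatr_eq0 -lt0n.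
have bE : (fun i => N%:R * bary T (node T b) i) = fun i => (b i)%:R.
  apply/funext => i; rewrite bary_point//; first by rewrite mulrC divfK.
  by rewrite -mulr_suml -natr_sum; move/eqP: bN => ->; rewrite divff.
rewrite ev_interp bE (bigD1 b)//= silvester_node// eqxx mulr1.
rewrite big1 ?addr0// => a /andP[aN ab].
by rewrite silvester_node// (negPf ab) mulr0.
Qed.

(** The basis functions are fixed polynomials in the barycentric coordinates, which
    lie between 0 and 1 and have a Lipschitz constant at most [s^-1]
    ([bary_lipschitz]). *)
Lemma ex_interp_stable N : exists K : R, 0 < K /\
  forall T y (s G : R) g, affinely_independent T -> 0 < s -> cube y s `<=` simplex T ->
    (forall a : {ffun 'I_n.+1 -> 'I_N.+1}, lattice a -> `|g (node T a)| <= G) ->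
    bddlip (simplex T) (K * G) (K * G / s) (ev (interp N T g)).
Proof.
pose phi (a : {ffun 'I_n.+1 -> 'I_N.+1}) (l : 'rV[R]_n.+1) : R :=
  silvester (fun i => a i : nat) (fun i => N%:R * l ord0 i).
have /choice[BL HBL] : forall a, exists BL : R * R,
    bddlip [set l : 'rV[R]_n.+1 | `|l| <= 1] BL.1 BL.2 (phi a).
  move=> a; suff [B [L H]] : exists B L,
      bddlip [set l : 'rV[R]_n.+1 | `|l| <= 1] B L (phi a) by exists (B, L).
  apply: ex_bddlip_prod => i.
  pose q : {poly R} := (a i)`!%:R^-1 *: \prod_(m < a i) (N%:R *: 'X - m%:R%:P).
  have qE t : q.[t] = gen_binomial (N%:R * t) (a i).
    rewrite /q hornerZ horner_prod mulrC /gen_binomial; congr (_ * _).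
    by apply: eq_bigr => m _; rewrite !hornerE.
  have [B [L H]] := ex_bddlip_poly q.
  exists `|B|, (`|L| * 1).
  have := @bddlip_comp R R^o [set x : R | `|x| <= 1] _ [set l : 'rV[R]_n.+1 | `|l| <= 1]
    (fun l => l ord0 i) `|B| `|L| 1 (fun t => q.[t]).
  move=> HH; apply: bddlip_eq (HH _ _ _ _) => //=.
  - by apply: bddlipW H; exact: ler_norm.
  - by move=> x /=; apply: le_trans; exact: row_le_norm.
  - move=> x z _ _; rewrite mul1r.
    by have := row_le_norm (x - z) i; rewrite !mxE.
pose K := 1 + \sum_a (`|(BL a).1| + `|(BL a).2|).
have K0 : 0 < K by rewrite ltr_pwDl// sumr_ge0.
exists K; split=> // T y s G g aT s0 ysT gG.
have a0N : lattice [ffun i : 'I_n.+1 => if i == ord0 then ord_max else ord0 : 'I_N.+1].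
  apply/eqP; rewrite (bigD1 ord0)//= ffunE eqxx big1 ?addn0//.
  by move=> i i0; rewrite ffunE (negPf i0).
have G0 : 0 <= G by exact: le_trans (normr_ge0 _) (gG _ a0N).
have {}HBL a : bddlip [set l | `|l| <= 1] `|(BL a).1| `|(BL a).2| (phi a).
  by apply: bddlipW (HBL a); exact: ler_norm.
pose F l := \sum_(a : {ffun 'I_n.+1 -> 'I_N.+1} | lattice a) g (node T a) * phi a l.
have HF : bddlip [set l | `|l| <= 1] (K * G) (K * G) F.
  have le1 (c : R) : 0 <= c -> c <= K -> c * G <= K * G by move=> _; exact: ler_wpM2r.
  have leK (P : pred {ffun 'I_n.+1 -> 'I_N.+1}) (c : _ -> R) : (forall a, 0 <= c a) ->
      (forall a, c a <= `|(BL a).1| + `|(BL a).2|) -> \sum_(a | P a) c a <= K.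
    move=> c0 cB; rewrite /K -[leLHS]add0r lerD// [leLHS]big_mkcond/=.
    by apply: ler_sum => a _; case: ifP => // _; exact: le_trans (c0 a) (cB a).
  have gG' (a : {ffun 'I_n.+1 -> 'I_N.+1}) : lattice a ->
      bddlip [set l : 'rV[R]_n.+1 | `|l| <= 1] G 0 (fun=> g (node T a)).
    by move=> aN; have := bddlipW (gG _ aN) (lexx 0) (bddlip_cst _ _); exact.
  apply: bddlipW (bddlip_sum (fun a aN => bddlipM (gG' a aN) (HBL a))).
    rewrite -mulr_sumr mulrC le1 ?sumr_ge0// leK// => a.
    by rewrite lerDl.
  under eq_bigr do rewrite mulr0 addr0.
  rewrite -mulr_sumr mulrC le1 ?sumr_ge0// leK// => a.
  by rewrite lerDr.
have := @bddlip_comp _ _ _ _ (simplex T) (fun x => \row_i bary T x i)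
  (K * G) (K * G) s^-1 _ _ HF.
move=> HH; apply: bddlip_eq (HH _ _ _).
- move=> x _ /=; rewrite ev_interp; apply: eq_bigr => a _; congr (_ * _).
  by rewrite /phi; congr silvester; apply/funext => i; rewrite mxE.
- by rewrite mulr_ge0// ltW.
- move=> x xT /=; apply: row_norm_le => // i; rewrite mxE.
  by rewrite ger0_norm ?bary_le1//; move/(simplexP aT): xT.
- move=> x z _ _; apply: row_norm_le => [|i].
    by rewrite mulr_ge0// invr_ge0 ltW.
  by rewrite !mxE; exact: bary_lipschitz ysT _ _ _.
Qed.

(** On a face, the nodes outside of it do not contribute to the interpolant,
    and the others are nodes of any other simplex with the same face. *)
Lemma nodes_face_eq N T T' S S' p q x : affinely_independent T ->
  affinely_independent T' -> (0 < N)%N -> face T S = face T' S' ->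
  (msize p <= N.+1)%N -> (msize q <= N.+1)%N ->
  (forall a b : {ffun 'I_n.+1 -> 'I_N.+1}, lattice a -> lattice b ->
     face T S (node T a) -> node T a = node T' b -> ev p (node T a) = ev q (node T a)) ->
  face T S x -> ev p x = ev q x.
Proof.
move=> aT aT' N0 FF pN qN pq xS.
have N0' : N%:R != 0 :> R by rewrite pnatr_eq0 -lt0n.
have dN : (msize (p - q)%R <= N.+1)%N.
  by rewrite (leq_trans (msizeD_le _ _))// geq_max pN msizeN.
apply/eqP; rewrite -subr_eq0; apply/eqP.
have -> : ev p x - ev q x = ev (p - q) x by rewrite /ev mevalB.
rewrite -(interp_exact x aT N0 dN) ev_interp big1// => a aN.
have /(faceP aT)[x0 xS0] := xS.
have [aS|] := boolP [forall i, (i \in S) || ((a i : nat) == 0)%N]; last first.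
  rewrite negb_forall => /existsP[i]; rewrite negb_or => /andP[iS ai].
  rewrite /silvester (bigD1 i)//= xS0// mulr0.
  by rewrite (@gen_binomial_lt R 0) ?mul0r ?mulr0// lt0n.
have sum1 : \sum_i (a i)%:R / N%:R = 1 :> R.
  by rewrite -mulr_suml -natr_sum; move/eqP: (aN) => ->; rewrite divff.
have naS : face T S (node T a).
  apply/(faceP aT); split=> i; rewrite bary_point// ?divr_ge0// => iS.
  by move/forallP/(_ i): aS; rewrite (negPf iS)/= => /eqP ->; rewrite mul0r.
have /choice[f fP] : forall i, exists j, i \in S -> j \in S' /\ row i T = row j T'.
  move=> i; have [iS|iS] := boolP (i \in S); last by exists ord0.
  by have [j jS' E] := face_vertex aT aT' FF iS; exists j.
(* The same node in the numbering of the vertices of [T']. *)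
pose b0 j := (\sum_(i | f i == j) a i)%N.
have b0N : (\sum_j b0 j = N)%N.
  have /eqP E := aN; rewrite -[RHS]E.
  by rewrite [RHS](partition_big f xpredT).
have b0lt j : (b0 j < N.+1)%N.
  by rewrite ltnS -b0N (bigD1 j)//= leq_addr.
pose b : {ffun 'I_n.+1 -> 'I_N.+1} := [ffun j => Ordinal (b0lt j)].
have bN : lattice b.
  by apply/eqP; rewrite -[RHS]b0N; apply: eq_bigr => j _; rewrite ffunE.
have nab : node T a = node T' b.
  apply/rowP => k; rewrite !pointE.
  transitivity (\sum_i (a i)%:R / N%:R * T' (f i) k).
    apply: eq_bigr => i _; have /orP[iS|/eqP ->] := forallP aS i.
      by have [_ /rowP/(_ k)] := fP i iS; rewrite !mxE => ->.
    by rewrite !mul0r.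
  rewrite (partition_big f xpredT)//=; apply: eq_bigr => j _.
  rewrite ffunE/= natr_sum mulr_suml mulr_suml.
  by apply: eq_bigr => i /eqP ->.
have := pq a b aN bN naS nab => E.
by rewrite /ev mevalB -!/(ev _ _) E subrr mul0r.
Qed.

End interpolation.

(** * The estimate on one element *)

Section auxiliary.
Context (R : realType).

Lemma ex_argmax (I : finType) (i0 : I) (F : I -> R) : exists i, forall j, F j <= F i.
Proof.
have [i _ iF] := @Order.TotalTheory.arg_maxP _ R I i0 xpredT F isT.
by exists i => j; exact: iF.
Qed.

Lemma le_eps (a b c : R) : (forall t, 0 < t <= 1 -> a <= b + t * c) -> a <= b.
Proof.
move=> H; apply/ler_addgt0Pr => e e0.
have c0 : 0 < `|c| + 1 by rewrite ltr_wpDl.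
pose t := Num.min 1 (e / (`|c| + 1)).
have t0 : 0 < t by rewrite lt_min ltr01 divr_gt0.
have te : t <= e / (`|c| + 1) by rewrite ge_min lexx orbT.
apply: le_trans (H t _) _; first by rewrite t0 ge_min lexx.
rewrite lerD2l; apply: (@le_trans _ _ (t * (`|c| + 1))).
  by rewrite ler_wpM2l ?(ltW t0)// (le_trans (ler_norm c))// lerDl.
by rewrite -ler_pdivlMr.
Qed.

Lemma msize_mderiv n (i : 'I_n) (p : mpoly n R) : (msize (mderiv i p) <= msize p)%N.
Proof.
rewrite [leqLHS]msizeE; apply/bigmax_leqP_seq => m mp _.
have : mnm_add m (mnm1 i) \in msupp p.
  rewrite mcoeff_msupp; apply: contraTneq mp => p0.
  by rewrite mcoeff_msupp negbK mcoeff_mderiv p0 mul0rn.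
by move/msize_mdeg_lt; rewrite mdegD mdeg1 addn1 => /ltnW.
Qed.

Lemma convex_cube n (y : 'rV[R]_n) (s : R) : convex_set (cube y s).
Proof.
move=> x z t xs zs /andP[t0 t1]; rewrite /cube /=.
have -> : x + t *: (z - x) - y = (1 - t) *: (x - y) + t *: (z - y).
  rewrite scalerBl scale1r !scalerBr opprB; apply/rowP => i; rewrite !mxE; ring.
rewrite (le_trans (ler_normD _ _))// !normrZ !ger0_norm ?subr_ge0//.
apply: (@le_trans _ _ ((1 - t) * s + t * s)); last by rewrite -mulrDl subrK mul1r.
by rewrite lerD// ler_wpM2l ?subr_ge0.
Qed.

(** Contract the simplex slightly towards an interior point. *)
Lemma bddlip_closure n (T : 'M[R]_(n.+1, n)) y (F : 'rV[R]_n -> R) (B L M : R) :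
  affinely_independent T -> (simplex T)° y -> 0 <= L ->
  (forall x z, simplex T x -> simplex T z -> `|F x - F z| <= M * `|x - z|) ->
  bddlip (simplex T)° B L F -> bddlip (simplex T) B L F.
Proof.
move=> aT yT L0 FM [FB FL].
have yT' := interior_subset yT.
pose X x (t : R) := x + t *: (y - x).
have XU x t : simplex T x -> 0 < t <= 1 -> (simplex T)° (X x t).
  by move=> xT t01; exact: simplex_interior_segment.
have FX x t : simplex T x -> 0 < t <= 1 ->
    `|F x - F (X x t)| <= t * (M * `|y - x|).
  move=> xT t01; have /interior_subset XT := XU _ _ xT t01.
  apply: le_trans (FM _ _ xT XT) _.
  rewrite /X opprD addNKr normrN normrZ gtr0_norm; last by case/andP: t01.
  by rewrite mulrCA.
split=> [x xT|x z xT zT].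
  apply: (@le_eps _ _ (M * `|y - x|)) => t t01.
  have -> : F x = F (X x t) + (F x - F (X x t)) by rewrite addrC subrK.
  by rewrite (le_trans (ler_normD _ _))// lerD ?FX// FB//; exact: XU.
apply: (@le_eps _ _ (M * `|y - x| + M * `|y - z|)) => t t01.
have -> : F x - F z = F (X x t) - F (X z t) +
  ((F x - F (X x t)) - (F z - F (X z t))) by ring.
rewrite (le_trans (ler_normD _ _))// mulrDr lerD//.
  apply: (le_trans (FL _ _ (XU _ _ xT t01) (XU _ _ zT t01))).
  rewrite ler_wpM2l// (_ : X x t - X z t = (1 - t) *: (x - z)).
    have /andP[t0 t1] := t01.
    by rewrite normrZ ger0_norm ?subr_ge0// ler_piMl// lerBlDr lerDl ltW.
  by rewrite /X; apply/rowP => i; rewrite !mxE; ring.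
by rewrite (le_trans (ler_normB _ _))// lerD ?FX.
Qed.

End auxiliary.

Section taylor.
Context (R : realType) (n : nat) (U : set 'rV[R]_n) (w : 'rV[R]_n -> R)
  (A d h : R) (y : 'rV[R]_n).
Hypotheses (cU : convex_set U) (d0 : 0 < d) (Uy : U y)
  (Uh : forall x, U x -> `|x - y| <= h).
Hypotheses (gw : has_gradient U w (fun i => partial i w))
  (ggw : forall i, has_gradient U (partial i w) (fun j => partial j (partial i w)))
  (wA : forall x, U x -> `|w x| <= A)
  (gwA : forall i x, U x -> `|partial i w x| <= A / d)
  (ggwA : forall i j x, U x -> `|partial j (partial i w) x| <= A / d ^+ 2).

Definition square_slope : 'rV[R]_n := \row_i (2 * w y * partial i w y).

Definition lin (a y x : 'rV[R]_n) : R := \sum_i a ord0 i * (x ord0 i - y ord0 i).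

Lemma bddlip_w : bddlip U A (n%:R * (A / d)) w.
Proof.
split=> // x z Ux Uz.
by apply: (gradient_le_lipschitz cU gw).
Qed.

Lemma is_derive_lin (a z v : 'rV[R]_n) :
  is_derive z v (lin a y) (\sum_i v ord0 i * a ord0 i).
Proof.
apply/is_derive_cvg; apply: (@cvg_trans _ ((fun=> \sum_i v ord0 i * a ord0 i) @ 0^')).
  2: exact: cvg_cst.
apply: near_eq_cvg; near=> t.
have t0 : t != 0 by near: t; exact: nbhs_dnbhs_neq.
rewrite /lin -sumrB scaler_sumr; apply: eq_bigr => i _.
by rewrite !mxE -[RHS]/(_ * _); field.
Unshelve. all: by end_near. Qed.

(** The remainder of the first order Taylor expansion of [w ^+ 2] at [y]: its
    gradient is [2 * (w * grad w - (w * grad w) y)], where [w * grad w] has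
    Lipschitz constant of order [A ^+ 2 / d ^+ 2]. *)
Lemma remainder_bddlip :
  let K := n%:R * (2 * (2 * n%:R * A ^+ 2)) in
  bddlip U (K * (h ^+ 2 / d ^+ 2)) (K * (h / d ^+ 2))
    (fun x => w x ^+ 2 - w y ^+ 2 - lin square_slope y x).
Proof.
move=> K.
have A0 : 0 <= A by exact: le_trans (normr_ge0 _) (wA Uy).
have h0 : 0 <= h by exact: le_trans (normr_ge0 _) (Uh Uy).
pose P i x := w x * partial i w x.
have PL i x : U x -> `|P i x - P i y| <= 2 * n%:R * A ^+ 2 * (h / d ^+ 2).
  move=> Ux; have gL : bddlip U (A / d) (n%:R * (A / d ^+ 2)) (partial i w).
    split=> [z Uz|z z' Uz Uz']; first exact: gwA.
    by apply: (gradient_le_lipschitz cU (ggw i)) => // j t; exact: ggwA.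
  have [_ H] := bddlipM bddlip_w gL.
  apply: le_trans (H x y Ux Uy) _.
  have -> : A * (n%:R * (A / d ^+ 2)) + A / d * (n%:R * (A / d)) =
    2 * n%:R * A ^+ 2 / d ^+ 2 by field; rewrite gt_eqF.
  rewrite mulrA mulrAC ler_wpM2r ?invr_ge0 ?sqr_ge0//.
  by rewrite ler_wpM2l ?Uh// !mulr_ge0// sqr_ge0.
have gr : has_gradient U (fun x => w x ^+ 2 - w y ^+ 2 - lin square_slope y x)
    (fun i x => 2 * (P i x - P i y)).
  move=> x v Ux.
  have H := is_deriveB (is_deriveB (is_deriveM (gw v Ux) (gw v Ux))
    (is_derive_cst (w y ^+ 2) x v)) (is_derive_lin square_slope x v).
  apply: is_derive_eq H _.
  rewrite subr0 -[in LHS]scalerDr -big_split [_ *: _]mulr_sumr -sumrB.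
  by apply: eq_bigr => i _; rewrite /= !mxE /P; ring.
have L x z : U x -> U z -> `|(w x ^+ 2 - w y ^+ 2 - lin square_slope y x) -
    (w z ^+ 2 - w y ^+ 2 - lin square_slope y z)| <= K * (h / d ^+ 2) * `|x - z|.
  move=> Ux Uz; rewrite /K -[n%:R * _ * (_ / _)]mulrA.
  apply: (gradient_le_lipschitz cU gr) => // i t Ut.
  by rewrite normrM ger0_norm// -[leRHS]mulrA ler_wpM2l// PL.
split=> // x Ux; have := L x y Ux Uy.
have -> : lin square_slope y y = 0.
  by rewrite /lin big1// => i _; rewrite subrr mulr0.
rewrite subrr subr0 subr0 => /le_trans; apply.
have K0 : 0 <= K by rewrite !mulr_ge0// sqr_ge0.
rewrite -mulrA ler_wpM2l// expr2 mulrAC ler_wpM2r ?invr_ge0 ?sqr_ge0//.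
by rewrite ler_wpM2l// Uh.
Qed.

End taylor.

Section arithmetic.
Context (R : realType).

Lemma cross_le (P Q a b : R) : 0 <= P -> 0 <= Q -> 0 <= a -> 0 <= b ->
  P * b + Q * a <= (P + Q) * (a + b).
Proof.
move=> P0 Q0 a0 b0; have := mulr_ge0 P0 a0; have := mulr_ge0 Q0 b0; clear; nra.
Qed.

Lemma quarter_half (s h : R) : 0 < s * h -> s / 4 * h + s / 2 * h < s * h.
Proof. by clear; lra. Qed.

Lemma sum_sqr_le (b u v : R) : 0 <= u -> 0 <= v ->
  (b * u) ^+ 2 + (b * v) ^+ 2 <= (b * (u + v)) ^+ 2.
Proof.
move=> u0 v0; rewrite !exprMn -mulrDr ler_wpM2l ?sqr_ge0//.
by rewrite sqrrD [leRHS]addrAC lerDl mulrn_wge0// mulr_ge0.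
Qed.

(** Here [a] is the size of the weight, [M] and [G] are the sizes of a polynomial
    and of its gradient, [v] is the square root of a volume, and [q] and [x] are
    the [L_2] norms of the gradient of the weighted polynomial and of the
    polynomial. *)
Lemma combine_norms (h d a G M v q x K : R) : 0 <= h -> 0 < d -> 0 <= K -> 0 <= q ->
  0 <= x -> (a * G / 2 - K * M / d) * v <= q -> M / 2 * v <= x ->
  (h / d * (a * G) + h / d ^+ 2 * M) * v <= (2 + 4 * K) * (h / d * q + h / d ^+ 2 * x).
Proof.
move=> h0 d0 K0 q0 x0 Hq Hx; have d00 : d != 0 by rewrite gt_eqF.
have hd : 0 <= h / d by rewrite divr_ge0// ltW.
have hd2 : 0 <= h / d ^+ 2 by rewrite divr_ge0// sqr_ge0.
have Hx' : M * v <= 2 * x by move: Hx; clear; lra.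
have Hq' : a * G * v <= 2 * q + 4 * K * x / d.
  have -> : a * G * v =
    2 * ((a * G / 2 - K * M / d) * v) + 2 * (K / d) * (M * v) by field.
  have -> : 4 * K * x / d = 2 * (K / d) * (2 * x) by field.
  by rewrite lerD ?ler_wpM2l// mulr_ge0// divr_ge0// ltW.
have -> : (h / d * (a * G) + h / d ^+ 2 * M) * v =
  h / d * (a * G * v) + h / d ^+ 2 * (M * v) by ring.
apply: le_trans (lerD (ler_wpM2l hd Hq') (ler_wpM2l hd2 Hx')) _.
rewrite -subr_ge0 (_ : _ - _ = 4 * K * (h / d * q)); last by field.
by apply: mulr_ge0; apply: mulr_ge0.
Qed.

Lemma half_sub (m a b : R) : m - b <= a -> a <= m / 2 -> m / 2 <= b.
Proof. by clear; lra. Qed.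

Lemma lin_bddlip n (D : set 'rV[R]_n) (a y : 'rV[R]_n) (c h : R) : 0 <= c ->
  (forall i, `|a ord0 i| <= c) -> (forall x, D x -> `|x - y| <= h) ->
  bddlip D (n%:R * c * h) (n%:R * c) (lin a y).
Proof.
move=> c0 ac Dh.
have L x z : `|lin a y x - lin a y z| <= n%:R * c * `|x - z|.
  rewrite /lin -sumrB (le_trans (ler_norm_sum _ _ _))//.
  apply: (@le_trans _ _ (\sum_(i < n) c * `|x - z|)).
    apply: ler_sum => i _; rewrite -mulrBr normrM ler_pM//.
    by have := row_le_norm (x - z) i; rewrite !mxE opprB addrA subrK.
  by rewrite sumr_const card_ord -[leLHS]mulr_natl mulrA.
split=> // x Dx; have := L x y; rewrite [X in _ - X]/lin.
rewrite [X in `|_ - X|]big1 ?subr0 => [/le_trans|i _]; last by rewrite subrr mulr0.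
by apply; rewrite ler_wpM2l ?mulr_ge0// Dh.
Qed.

Definition lin_mpoly n (a y : 'rV[R]_n) : mpoly n R :=
  \sum_i a ord0 i *: (mpolyX R (mnm1 i) - mpolyC n (y ord0 i)).

Lemma ev_lin_mpoly n (a y x : 'rV[R]_n) : ev (lin_mpoly a y) x = lin a y x.
Proof.
rewrite /ev raddf_sum; apply: eq_bigr => i _ /=.
by rewrite mevalZ mevalB mevalXU mevalC.
Qed.

Lemma msize_lin_mpoly n (a y : 'rV[R]_n) : (msize (lin_mpoly a y) <= 2)%N.
Proof.
apply: msize_sum_deg => i _; apply: leq_trans (msizeZ_le _ _) _.
rewrite (leq_trans (msizeD_le _ _))// geq_max msizeX mdeg1 msizeN msizeC.
by case: (_ == _).
Qed.

Lemma ev_interpD n N (T : 'M[R]_(n.+1, n)) (g1 g2 g : 'rV[R]_n -> R) x :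
  (forall z, g z = g1 z + g2 z) ->
  ev (interp N T g) x = ev (interp N T g1) x + ev (interp N T g2) x.
Proof.
move=> E; rewrite !ev_interp -big_split; apply: eq_bigr => a _ /=.
by rewrite E mulrDl.
Qed.

End arithmetic.

Lemma node_simplex (R : realType) n N (T : 'M[R]_(n.+1, n))
  (a : {ffun 'I_n.+1 -> 'I_N.+1}) : affinely_independent T -> (0 < N)%N ->
  lattice a -> simplex T (node T a).
Proof.
move=> aT N0 /eqP aN; apply/(simplexP aT) => i.
rewrite bary_point ?divr_ge0//.
by rewrite -mulr_suml -natr_sum aN divff// pnatr_eq0 -lt0n.
Qed.

Section local_estimate.
Context (R : realType) (n N : nat) (s K2 K5 A : R).
Hypotheses (n0 : (0 < n)%N) (N0 : (0 < N)%N) (s0 : 0 < s) (K20 : 0 < K2) (K50 : 0 < K5).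
Hypothesis grid_bound : forall (p : mpoly n R) (y : 'rV[R]_n) (h M : R),
  (msize p <= N.+1)%N -> 0 < h ->
  (forall b : {ffun 'I_n -> 'I_N.+1}, `|ev p (y + h *: grid (s / 2) b)| <= M) ->
  bddlip (cube y h) (K2 * M) (K2 * M / h) (ev p).
Hypothesis stable : forall (T : 'M[R]_(n.+1, n)) y (s G : R) g,
  affinely_independent T -> 0 < s -> cube y s `<=` simplex T ->
  (forall a : {ffun 'I_n.+1 -> 'I_N.+1}, lattice a -> `|g (node T a)| <= G) ->
  bddlip (simplex T) (K5 * G) (K5 * G / s) (ev (interp N T g)).

Context (T : 'M[R]_(n.+1, n)) (y : 'rV[R]_n) (h d : R) (w W : 'rV[R]_n -> R)
  (p : mpoly n R).
Hypotheses (aT : affinely_independent T) (h0 : 0 < h) (d0 : 0 < d)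
  (hT : forall x z, simplex T x -> simplex T z -> `|x - z| <= h)
  (ysT : cube y (s * h) `<=` simplex T) (pN : (msize p <= N.+1)%N).
Let U := (simplex T)°.

(* The size, relative to [h], of the cubes on which a polynomial stays within a
   factor 2 of its largest grid value: they have to lie in the inscribed cube,
   and the Lipschitz constant [K2 * M / h] allows a variation of [M / 2]. *)
Let kappa : R := Num.min (s / 4) (2 * K2)^-1.

Let kappa0 : 0 < kappa.
Proof. by rewrite lt_min !divr_gt0//= invr_gt0 mulr_gt0. Qed.

Let Uball x : `|x - y| < s * h -> U x.
Proof.
move=> xy; suff : \forall z \near x, simplex T z by [].
apply/nbhs_normP; exists (s * h - `|x - y|); first by rewrite /= subr_gt0.
move=> z /= zx; apply: ysT; rewrite /cube /=.
apply: le_trans (ler_distD x _ _) _.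
by rewrite distrC -lerBrDr ltW.
Qed.

Let Uy : U y.
Proof. by apply: Uball; rewrite subrr normr0 mulr_gt0. Qed.

Let Tcube x : simplex T x -> cube y h x.
Proof. by move=> xT; apply: hT => //; exact: (interior_subset Uy). Qed.

(** The cube is centred at the grid point with the largest value over the whole
    family; the Lipschitz bound from [grid_control] limits the decrease away from
    this point. *)
Lemma polys_max (I : finType) (i0 : I) (q : I -> mpoly n R) :
  (forall i, msize (q i) <= N.+1)%N ->
  exists i g (M : R), [/\ 0 <= M,
    forall j, bddlip (cube y h) (K2 * M) (K2 * M / h) (ev (q j)),
    cube g (kappa * h) `<=` U &
    forall x, cube g (kappa * h) x -> M / 2 <= `|ev (q i) x|].
Proof.
move=> qN.
have [[i b] ibmax] := ex_argmax (i0, [ffun=> ord0] : {ffun 'I_n -> 'I_N.+1})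
  (fun ib => `|ev (q ib.1) (y + h *: grid (s / 2) ib.2)|).
pose g := y + h *: grid (s / 2) b; set M := `|ev (q i) g|.
have M0 : 0 <= M by exact: normr_ge0.
have qj j : bddlip (cube y h) (K2 * M) (K2 * M / h) (ev (q j)).
  by apply: grid_bound => // b'; exact: (ibmax (j, b')).
have gy : `|g - y| <= s / 2 * h.
  rewrite /g addrC addKr normrZ gtr0_norm// mulrC ler_wpM2r ?(ltW h0)//.
  by apply: grid_norm; rewrite divr_gt0.
have sh0 : 0 < s * h by rewrite mulr_gt0.
have gU : cube g (kappa * h) `<=` U.
  move=> x xg; apply: Uball; apply: le_lt_trans (ler_distD g _ _) _.
  have xg' : `|x - g| <= s / 4 * h.
    by apply: le_trans xg _; rewrite ler_wpM2r ?(ltW h0)// ge_min lexx.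
  apply: le_lt_trans (lerD xg' gy) _.
  exact: quarter_half.
exists i, g, M; split=> // x xg.
have gg : cube g (kappa * h) g.
  by rewrite /cube /= subrr normr0; exact: (mulr_ge0 (ltW kappa0) (ltW h0)).
have UT z : U z -> cube y h z by move=> /interior_subset; exact: Tcube.
have gin : cube y h g by exact/UT/gU.
have xin : cube y h x by exact/UT/gU.
have [_ /(_ g x gin xin) H] := qj i.
have H2 : K2 * M / h * `|g - x| <= M / 2.
  rewrite distrC; apply: (@le_trans _ _ (K2 * M / h * ((2 * K2)^-1 * h))).
    rewrite ler_wpM2l ?divr_ge0 ?mulr_ge0 ?(ltW K20) ?(ltW h0)//.
    by apply: le_trans xg _; rewrite ler_wpM2r ?(ltW h0)// ge_min lexx orbT.
  by rewrite le_eqVlt; apply/orP; left; apply/eqP; field; rewrite !gt_eqF.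
exact: half_sub (lerB_dist _ _) (le_trans H H2).
Qed.

Hypotheses
  (gw : has_gradient U w (fun i => partial i w))
  (ggw : forall i, has_gradient U (partial i w) (fun j => partial j (partial i w)))
  (wA : forall x, U x -> `|w x| <= A)
  (gwA : forall i x, U x -> `|partial i w x| <= A / d)
  (ggwA : forall i j x, U x -> `|partial j (partial i w) x| <= A / d ^+ 2).
Hypotheses (WL : forall x z, `|W x - W z| <= n%:R * (A / d) * `|x - z|)
  (Ww : forall x, U x -> W x = w x).

Let cU : convex_set U. Proof. exact: convex_simplex_interior. Qed.
Let oU : open U. Proof. exact: open_interior. Qed.
Let Uh x : U x -> `|x - y| <= h.
Proof. by move=> /interior_subset /Tcube. Qed.
Let A0 : 0 <= A.
Proof. exact: le_trans (normr_ge0 _) (wA Uy). Qed.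

(* The constants of the Taylor remainder, of [E] below, and of [E - I E]. *)
Let K1 : R := n%:R * (2 * (2 * n%:R * A ^+ 2)).
Let K4 : R := 2 * K1 * K2 + 4 * n%:R ^+ 2 * A * K2.
Let K6 : R := K4 + K5 * K4 + K5 * K4 / s.

Let K40 : 0 <= K4.
Proof.
have K20' : 0 <= K2 := ltW K20.
by apply: addr_ge0; rewrite !mulr_ge0// sqr_ge0.
Qed.

Let K60 : 0 <= K6.
Proof.
have K50' : 0 <= K5 := ltW K50.
by rewrite !addr_ge0 ?divr_ge0 ?mulr_ge0// ltW.
Qed.

Let u x := w x ^+ 2 * ev p x - ev (interp N T (fun z => W z ^+ 2 * ev p z)) x.

(** With [c = p(y)], [l] the linear part and [rho] the remainder of [w ^+ 2] at
    [y], put [E = rho * p + l * (p - c)]. The function [w ^+ 2 * p] differs from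
    [E] by the polynomial [w y ^+ 2 * p + c * l] of degree at most [N], which the
    interpolation [I] reproduces, so that the error is [E - I E]. *)
Lemma error_bddlip (M G : R) : 0 <= M -> 0 <= G ->
  bddlip (cube y h) (K2 * M) (K2 * M / h) (ev p) ->
  (forall i x, cube y h x -> `|ev (mderiv i p) x| <= K2 * G) ->
  let Y := h / d * (`|w y| * G) + h / d ^+ 2 * M in
  bddlip U (K6 * (h * Y)) (K6 * Y) u.
Proof.
move=> M0 G0 fM fG Y.
set w0 := w y; set c := ev p y; set sl := square_slope w y.
have K10 : 0 <= K1 by rewrite !mulr_ge0// sqr_ge0.
have nA0 : 0 <= n%:R * (A / d) by rewrite mulr_ge0// divr_ge0// ltW.
have Td x : simplex T x -> `|x - y| <= h by exact: Tcube.
have bW : bddlip (simplex T) A (n%:R * (A / d)) W.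
  apply: (@bddlip_closure _ _ T y W _ _ (n%:R * (A / d))) => //.
  by split=> [x Ux|x z _ _]; [rewrite Ww// wA|exact: WL].
have bsl : bddlip (simplex T) (n%:R * (2 * `|w0| * (A / d)) * h)
    (n%:R * (2 * `|w0| * (A / d))) (lin sl y).
  apply: lin_bddlip => // [|i]; first by rewrite !mulr_ge0// invr_ge0 ltW.
  by rewrite mxE !normrM ger0_norm// ler_wpM2l ?mulr_ge0// gwA.
have bR : bddlip (simplex T) (K1 * (h ^+ 2 / d ^+ 2)) (K1 * (h / d ^+ 2))
    (fun x => W x ^+ 2 - w0 ^+ 2 - lin sl y x).
  have [_ Lip] := bddlipB (bddlipB (bddlipM bW bW)
    (bddlip_cst (simplex T) (w0 ^+ 2))) bsl.
  have L0 : 0 <= K1 * (h / d ^+ 2).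
    by apply: mulr_ge0 => //; apply: divr_ge0; [exact: ltW|exact: sqr_ge0].
  apply: (bddlip_closure aT Uy L0 Lip).
  have := remainder_bddlip cU d0 Uy Uh gw ggw wA gwA ggwA.
  by apply: bddlip_eq => x Ux; rewrite Ww.
have bf : bddlip (simplex T) (K2 * M) (K2 * M / h) (ev p).
  by have [fB fL] := fM; split=> [x /Tcube|x z /Tcube xc /Tcube]; [exact: fB|exact: fL].
have bfc : bddlip (simplex T) (n%:R * (K2 * G) * h) (n%:R * (K2 * G))
    (fun x => ev p x - c).
  have L x z : simplex T x -> simplex T z -> `|ev p x - ev p z| <=
      n%:R * (K2 * G) * `|x - z|.
    move=> /Tcube xc /Tcube zc.
    exact: (gradient_le_lipschitz (@convex_cube _ _ y h)
      (@has_gradient_ev R n _ p) fG xc zc).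
  split=> [x xT|x z xT zT]; last by rewrite opprB addrA subrK L.
  apply: le_trans (L _ _ xT (interior_subset Uy)) _.
  by rewrite ler_wpM2l ?Td// !mulr_ge0// ltW.
pose E x := (W x ^+ 2 - w0 ^+ 2 - lin sl y x) * ev p x + lin sl y x * (ev p x - c).
pose P0 : mpoly n R := w0 ^+ 2 *: p + c *: lin_mpoly sl y.
have P0N : (msize P0 <= N.+1)%N.
  rewrite (leq_trans (msizeD_le _ _))// geq_max.
  rewrite (leq_trans (msizeZ_le _ _))//= (leq_trans (msizeZ_le _ _))//.
  exact: leq_trans (msize_lin_mpoly _ _) _.
have P0E z : ev P0 z = w0 ^+ 2 * ev p z + c * lin sl y z.
  by rewrite -ev_lin_mpoly /ev /P0 mevalD !mevalZ.
have WfE z : W z ^+ 2 * ev p z = E z + ev P0 z by rewrite P0E /E; ring.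
have Y0 : 0 <= Y.
  by rewrite addr_ge0// !mulr_ge0// ?invr_ge0 ?sqr_ge0// ltW.
have bE : bddlip (simplex T) (K4 * (h * Y)) (K4 * Y) E.
  have := bddlipD (bddlipM bR bf) (bddlipM bsl bfc).
  have hd : 0 <= h / d * (`|w0| * G) by rewrite !mulr_ge0// ?invr_ge0 ltW.
  have hd2 : 0 <= h / d ^+ 2 * M by rewrite !mulr_ge0// ?invr_ge0 ?sqr_ge0// ltW.
  have k1 : 0 <= 2 * K1 * K2 by rewrite !mulr_ge0// ltW.
  have k2 : 0 <= 4 * n%:R ^+ 2 * A * K2 by rewrite !mulr_ge0// ?sqr_ge0// ltW.
  have cross := cross_le k1 k2 hd hd2.
  have d00 : d != 0 by rewrite gt_eqF.
  have h00 : h != 0 by rewrite gt_eqF.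
  have hK4 : h * (2 * K1 * K2 * (h / d ^+ 2 * M)
      + 4 * n%:R ^+ 2 * A * K2 * (h / d * (`|w0| * G))) <= K4 * (h * Y).
    by rewrite [leRHS]mulrCA ler_wpM2l// ltW.
  apply: bddlipW; last 1 first.
  - apply: (@le_trans _ _ (2 * K1 * K2 * (h / d ^+ 2 * M)
      + 4 * n%:R ^+ 2 * A * K2 * (h / d * (`|w0| * G)))) => //.
    by rewrite le_eqVlt; apply/orP; left; apply/eqP; field; rewrite d00.
  apply: le_trans hK4.
  rewrite [leRHS](_ : _ = (K1 * (h ^+ 2 / d ^+ 2) * (K2 * M) +
     n%:R * (2 * `|w0| * (A / d)) * h * (n%:R * (K2 * G) * h)) * 2).
    have h0' := ltW h0; have d0' := ltW d0; have K20' := ltW K20.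
    by rewrite ler_peMr ?ler1n// addr_ge0// !mulr_ge0// invr_ge0// sqr_ge0.
  by field.
have sh0 : 0 < s * h by rewrite mulr_gt0.
have bI := stable aT sh0 ysT (fun a aN => bE.1 _ (node_simplex aT N0 aN)).
have UT : U `<=` simplex T by exact: interior_subset.
apply: (@bddlip_eq _ _ _ _ _ (fun x => E x - ev (interp N T E) x)).
  move=> x Ux; rewrite /u -(Ww Ux) (@ev_interpD _ _ N T _ _ _ x WfE).
  rewrite (interp_exact x aT N0 P0N).
  by rewrite WfE; ring.
have hY0 : 0 <= h * Y by rewrite mulr_ge0// ltW.
have K54 : 0 <= K5 * K4 by rewrite mulr_ge0// ltW.
have K54s : 0 <= K5 * K4 / s by rewrite divr_ge0// ltW.
apply: bddlipW (bddlipS UT (bddlipB bE bI)).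
  by rewrite /K6 [K5 * _]mulrA -mulrDl ler_wpM2r// lerDl.
have -> : K5 * (K4 * (h * Y)) / (s * h) = K5 * K4 / s * Y.
  by field; rewrite !gt_eqF.
by rewrite /K6 -mulrDl ler_wpM2r// [leRHS]addrAC lerDl.
Qed.

Lemma H1norm_error_le (M G H0 : R) (chi eta : 'rV[R]_n -> R) : h <= H0 ->
  0 <= M -> 0 <= G ->
  bddlip (cube y h) (K2 * M) (K2 * M / h) (ev p) ->
  (forall i x, cube y h x -> `|ev (mderiv i p) x| <= K2 * G) ->
  (forall x, U x -> chi x = ev p x) ->
  (forall x, U x -> eta x = ev (interp N T (fun z => W z ^+ 2 * ev p z)) x) ->
  (H1norm U (fun x => w x ^+ 2 * chi x - eta x)%R
    <= (K6 * (H0 + n%:R) * (h / d * (`|w y| * G) + h / d ^+ 2 * M) *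
        Num.sqrt ((h *+ 2) ^+ n))%:E)%E.
Proof.
move=> hH0 M0 G0 fM fG chiE etaE; set Y := h / d * _ + _.
have [uB uL] := error_bddlip M0 G0 fM fG.
rewrite -/Y in uB uL.
have Y0 : 0 <= Y by rewrite addr_ge0// !mulr_ge0// ?invr_ge0 ?sqr_ge0// ltW.
have uY : 0 <= K6 * Y by rewrite mulr_ge0.
have hu : has_gradient U (fun x => w x ^+ 2 * chi x - eta x)
  (fun i x => (w x * w x * ev (mderiv i p) x +
     ev p x * (w x * partial i w x + w x * partial i w x)) -
     ev (mderiv i (interp N T (fun z => W z ^+ 2 * ev p z))) x).
  apply: (has_gradient_eq oU _ (has_gradientB
    (has_gradientM (has_gradientM gw gw) (@has_gradient_ev R n U p))
    (@has_gradient_ev R n U (interp N T (fun z => W z ^+ 2 * ev p z))))).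
  by move=> x Ux; rewrite chiE// etaE.
have part i x : U x -> `|partial i (fun x => w x ^+ 2 * chi x - eta x) x| <= K6 * Y.
  move=> Ux; rewrite (has_gradient_partial hu)//.
  have H := @gradient_le_of_lipschitz _ _ _ _ _ (K6 * Y) x i oU hu.
  apply: H => // z z' Uz Uz'.
  by rewrite !chiE// !etaE//; exact: uL.
have H00 : 0 <= H0 by apply: le_trans hH0; exact: ltW.
rewrite (_ : K6 * _ * Y = (K6 * Y) * (H0 + n%:R)); last by ring.
apply: (@H1norm_le _ _ _ y h) => //; first exact: ltW.
  by rewrite mulr_ge0// addr_ge0.
move=> x Ux; set B := K6 * Y.
have b1 : (w x ^+ 2 * chi x - eta x) ^+ 2 <= (B * H0) ^+ 2.
  have ub : `|w x ^+ 2 * chi x - eta x| <= B * H0.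
    rewrite chiE// etaE//; apply: le_trans (uB _ Ux) _.
    by rewrite mulrCA mulrC ler_wpM2l.
  rewrite -[leLHS]real_normK ?num_real//; apply: lerXn2r ub => //.
  by rewrite nnegrE mulr_ge0.
have b2 : enorm (gradient (fun x => w x ^+ 2 * chi x - eta x) x) ^+ 2 <= (B * n%:R) ^+ 2.
  have ub : enorm (gradient (fun x => w x ^+ 2 * chi x - eta x) x) <= n%:R * B.
    by apply: enorm_le => // i; rewrite mxE part.
  rewrite [B * _]mulrC; apply: lerXn2r ub; rewrite nnegrE ?sqrtr_ge0//.
  by rewrite mulr_ge0.
exact: le_trans (lerD b1 b2) (sum_sqr_le _ H00 _).
Qed.

(* It bounds, up to the factor [M / d], what is lost when [w] is replaced by [w y]
   in the gradient of [w * p], and the term [p * grad w] of this gradient. *)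
Let K3 : R := (n.+1)%:R * K2 * A.

Definition local_constant (H0 : R) : R :=
  K6 * (H0 + n%:R) * ((Num.sqrt (kappa ^+ n))^-1 * (2 + 4 * K3)).

(** The right-hand side is bounded below by integrals over two small cubes, one
    where the polynomial is large and one where a partial derivative is large. On
    the second one the gradient of [w * p] is at least
    [`|w y| * G / 2 - K3 * M / d]. *)
Lemma local_estimate (H0 C : R) (chi eta : 'rV[R]_n -> R) : h <= H0 ->
  (forall x, U x -> chi x = ev p x) ->
  (forall x, U x -> eta x = ev (interp N T (fun z => W z ^+ 2 * ev p z)) x) ->
  local_constant H0 <= C -> 0 < C ->
  (H1norm U (fun x => w x ^+ 2 * chi x - eta x)%R <= C%:E *
    ((h / d)%:E * L2norm U (fun x => enorm (gradient (fun y => w y * chi y)%R x))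
     + (h / d ^+ 2)%:E * L2norm U chi))%E.
Proof.
move=> hH0 chiE etaE lC C0.
have [_ [g [M [M0 Mb MU Mlow]]]] := polys_max tt (fun=> pN).
have [i [g' [G [G0 Gb GU Glow]]]] := polys_max (Ordinal n0)
  (fun i => leq_trans (msize_mderiv i p) pN).
have := H1norm_error_le hH0 M0 G0 (Mb tt) (fun i x xc => (Gb i).1 x xc) chiE etaE.
set a := `|w y|; set Y := h / d * _ + _; set V := Num.sqrt _ => H1.
set v := Num.sqrt ((kappa * h *+ 2) ^+ n).
have h0' : 0 <= h := ltW h0.
have d0' : 0 <= d := ltW d0.
have kh0 : 0 <= kappa * h by rewrite mulr_ge0// ltW.
have hX : ((M / 2 * v)%:E <= L2norm U chi)%E.
  apply: (L2norm_ge kh0 _ MU) => [|x xg]; first by rewrite divr_ge0.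
  by rewrite chiE ?Mlow//; exact: MU.
have K30 : 0 <= K3 by rewrite !mulr_ge0// ltW.
set m := Num.max 0 (a * G / 2 - K3 * M / d).
have hQ : ((m * v)%:E <=
    L2norm U (fun x => enorm (gradient (fun y => w y * chi y)%R x)))%E.
  apply: (L2norm_ge kh0 _ GU) => [|x xg]; first by rewrite le_max lexx.
  rewrite ger0_norm ?sqrtr_ge0// ge_max sqrtr_ge0/=.
  have Ux : U x := GU _ xg.
  have hwc : has_gradient U (fun x => w x * chi x)
      (fun i x => w x * ev (mderiv i p) x + ev p x * partial i w x).
    apply: (has_gradient_eq oU _ (has_gradientM gw (@has_gradient_ev R n U p))).
    by move=> z Uz; rewrite chiE.
  apply: le_trans (norm_le_enorm _); apply: le_trans (row_le_norm _ i).
  rewrite mxE (has_gradient_partial hwc)//.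
  have UT z : U z -> cube y h z by move=> /interior_subset; exact: Tcube.
  have pL : `|ev (mderiv i p) x| <= K2 * M / h.
    have H := @gradient_le_of_lipschitz _ _ _ _ _ (K2 * M / h) x i oU
      (@has_gradient_ev R n U p).
    apply: H => // z z' Uz Uz'.
    by have [_] := Mb tt; apply; exact: UT.
  have wL : `|w y - w x| <= n%:R * (A / d) * h.
    have [_ wL] := bddlip_w cU gw wA gwA.
    apply: le_trans (wL _ _ Uy Ux) _; rewrite ler_wpM2l//.
      by rewrite mulr_ge0// divr_ge0.
    by rewrite distrC Uh.
  have pB : `|ev p x| <= K2 * M by have [pB _] := Mb tt; exact/pB/UT.
  have wB := gwA i Ux.
  have aw : a <= `|w x| + `|w y - w x|.
    by rewrite -lerBlDl; exact: lerB_dist.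
  have t1 : a * (G / 2) <= `|w x| * `|ev (mderiv i p) x| +
      n%:R * (A / d) * h * (K2 * M / h).
    apply: (@le_trans _ _ (a * `|ev (mderiv i p) x|)).
      by rewrite ler_wpM2l// ?normr_ge0// Glow.
    apply: (@le_trans _ _ ((`|w x| + `|w y - w x|) * `|ev (mderiv i p) x|)).
      by rewrite ler_wpM2r.
    by rewrite mulrDl lerD2l ler_pM.
  have t2 : `|ev p x * partial i w x| <= K2 * M * (A / d).
    by rewrite normrM ler_pM.
  have t3 := lerB_dist (w x * ev (mderiv i p) x) (- (ev p x * partial i w x)).
  rewrite opprK normrN normrM in t3.
  apply: le_trans t3; rewrite lerBrDr.
  have -> : a * G / 2 - K3 * M / d = a * (G / 2) - n%:R * (A / d) * h * (K2 * M / h)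
      - K2 * M * (A / d).
    rewrite /K3 -natr1; field; by rewrite !gt_eqF.
  rewrite -lerBrDr; apply: (@le_trans _ _ (`|w x| * `|ev (mderiv i p) x| - K2 * M * (A / d))).
    by rewrite lerB// lerBlDr.
  by rewrite lerB.
apply: le_trans H1 _.
have v0 : 0 <= v by exact: sqrtr_ge0.
have VE : V = (Num.sqrt (kappa ^+ n))^-1 * v.
  rewrite /v /V -mulrnAr exprMn sqrtrM ?exprn_ge0// ?ltW//.
  by rewrite mulKf// gt_eqF// sqrtr_gt0 exprn_gt0.
have hd0 : 0 < h / d by rewrite divr_gt0.
have hd20 : 0 < h / d ^+ 2 by rewrite divr_gt0// exprn_gt0.
have K6C : 0 <= K6 * (H0 + n%:R).
  by rewrite mulr_ge0// addr_ge0// (le_trans h0').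
have m0 : 0 <= m by rewrite le_max lexx.
move: hQ hX; set Q := L2norm U _; set X := L2norm U _ => hQ hX.
(* The norms on the right may be infinite. *)
case: Q hQ => [q||]; last by [].
  case: X hX => [x||]; last by [].
    rewrite !lee_fin => hx hq.
    have q0 : 0 <= q by apply: le_trans hq; rewrite mulr_ge0.
    have x0 : 0 <= x by apply: le_trans hx; rewrite mulr_ge0 ?divr_ge0.
    have hq' : (a * G / 2 - K3 * M / d) * v <= q.
      by apply: le_trans hq; rewrite ler_wpM2r// le_max lexx orbT.
    have F := combine_norms h0' d0 K30 q0 x0 hq' hx.
    have -> : K6 * (H0 + n%:R) * Y * V =
        K6 * (H0 + n%:R) * (Num.sqrt (kappa ^+ n))^-1 * (Y * v).
      by rewrite VE -!mulrA; congr (_ * (_ * _)); rewrite mulrCA.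
    have i0 : 0 <= (Num.sqrt (kappa ^+ n))^-1 by rewrite invr_ge0 sqrtr_ge0.
    apply: le_trans (ler_wpM2l (mulr_ge0 K6C i0) F) _.
    rewrite mulrA ler_wpM2r//; last by rewrite -mulrA.
    by rewrite addr_ge0// mulr_ge0// ltW.
  move=> _ _; rewrite gt0_muley ?lte_fin// -EFinM addey// gt0_muley ?lte_fin// leey.
  by [].
move=> _; rewrite gt0_muley ?lte_fin// addye ?gt0_muley ?lte_fin ?leey//.
by case: X hX => [x _|_|//]; rewrite ?gt0_muley ?lte_fin.
Qed.

End local_estimate.

(** * Derivative bounds from the Sobolev seminorms *)

Section derivative_bounds.
Context (R : realType) (n : nat).
Implicit Types (s : seq 'I_n) (c : 'I_n -> nat).

Let le_ord : rel 'I_n := fun i j => (i <= j)%N.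

(** [Dmulti] differentiates in the sorted order of the variables. *)
Lemma sorted_blocks c : sorted le_ord (flatten [seq nseq (c i) i | i <- enum 'I_n]).
Proof.
have le_trans : transitive le_ord by move=> j i k; exact: leq_trans.
rewrite sorted_pairwise//.
have : pairwise (fun i j : 'I_n => (i < j)%N) (enum 'I_n).
  have lt_trans : transitive (fun i j : 'I_n => (i < j)%N).
    by move=> j i k; exact: ltn_trans.
  rewrite -sorted_pairwise//.
  by have := iota_ltn_sorted 0 n; rewrite -val_enum_ord sorted_map.
elim: (enum 'I_n) => //= i e IHe /andP[/allP ie /IHe pe].
rewrite pairwise_cat pe andbT; apply/andP; split.
  apply/allrelP => j k /nseqP[-> _] /flattenP[_ /mapP[l le ->] /nseqP[-> _]].
  exact/ltnW/ie.
elim: (c i) => //= k ->; rewrite andbT; apply/allP => j /nseqP[-> _].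
exact: leqnn.
Qed.

Lemma sorted_blocksE s : sorted le_ord s ->
  flatten [seq nseq (count_mem i s) i | i <- enum 'I_n] = s.
Proof.
move=> ss; apply: (@sorted_eq _ le_ord) => //.
- by move=> j i k; exact: leq_trans.
- by move=> i j; rewrite -eqn_leq => /eqP/val_inj.
- exact: sorted_blocks.
apply/allP => i _ /=; rewrite count_flatten sumnE 2!big_map big_enum/= (bigD1 i)//=.
rewrite count_nseq /= eqxx mul1n big1 ?addn0// => j ji.
by rewrite count_nseq/= (negPf ji).
Qed.

Lemma Dmulti_sorted s (u : 'rV[R]_n -> R) : sorted le_ord s ->
  exists2 a : multinom n, mdeg a = size s & Dmulti a u = partials s u.
Proof.
move=> ss; pose a : multinom n := Multinom [tuple count_mem i s | i < n].
have aE i : a i = count_mem i s by exact: mnmE.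
have E : flatten [seq nseq (a i) i | i <- enum 'I_n] = s.
  by rewrite -[RHS]sorted_blocksE//; congr flatten; apply: eq_map => i; rewrite aE.
exists a; last by rewrite /Dmulti E.
rewrite -[s in RHS]E size_flatten /shape -map_comp sumnE big_map big_enum/= mdegE.
by apply: eq_bigr => i _; rewrite size_nseq.
Qed.

Lemma Wseminorm_partials s (D : set 'rV[R]_n) (u : 'rV[R]_n -> R) (c : R) :
  open D -> smooth D u -> sorted le_ord s -> (Wseminorm_oo (size s) D u <= c%:E)%E ->
  forall x, D x -> `|partials s u x| <= c.
Proof.
move=> oD su ss Wc; have [a aN aE] := Dmulti_sorted u ss.
apply: Lpnorm_oo_le => //; first by have [] := su s.
apply: le_trans Wc; apply: ereal_sup_ubound.
by exists a => //; rewrite aE.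
Qed.

End derivative_bounds.

(** * The global interpolant *)

Lemma ex_ev_lipschitz (R : realType) n (p : mpoly n R) (B : R) : 0 < B ->
  exists2 L : R, 0 <= L & forall x z, `|x| <= B -> `|z| <= B ->
    `|ev p x - ev p z| <= L * `|x - z|.
Proof.
move=> B0; have r0 : (0 < (msize p).+1)%N by [].
have [K [K0 HK]] := @grid_control R n (msize p).+1 1 r0 ltr01.
pose M := \sum_(b : {ffun 'I_n -> 'I_(msize p).+1}) `|ev p (0 + B *: grid 1 b)|.
have M0 : 0 <= M by exact: sumr_ge0.
have [|_ H] := HK p 0 B M (leqnSn _) B0.
  by move=> b; rewrite /M (bigD1 b)//= lerDl sumr_ge0.
exists (K * M / B); first by rewrite divr_ge0 ?mulr_ge0// ltW.
by move=> x z xB zB; apply: H; rewrite /= subr0.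
Qed.

(** [W T] is a Lipschitz extension of [w] from the interior of [T]. It need not
    agree with [w] on the frontier of the domain, nor with the extension from an
    element on the other side of a slit. *)
Section global.
Context (R : realType) (n N : nat) (Omega : set 'rV[R]_n) (Th : seq 'M[R]_(n.+1, n)).
Hypotheses (N0 : (0 < N)%N) (oO : open Omega) (ThO : simplicial_decomposition Omega Th).
Context (w chi : 'rV[R]_n -> R) (L : R) (W : 'M[R]_(n.+1, n) -> 'rV[R]_n -> R)
  (p : 'M[R]_(n.+1, n) -> mpoly n R) (y : 'M[R]_(n.+1, n) -> 'rV[R]_n).
Hypotheses (L0 : 0 <= L) (cw : {within Omega, continuous w})
  (yT : forall T, T \in Th -> (simplex T)° (y T))
  (WL : forall T x z, T \in Th -> `|W T x - W T z| <= L * `|x - z|)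
  (Ww : forall T x, T \in Th -> (simplex T)° x -> W T x = w x)
  (pchi : forall T x, T \in Th -> simplex T x -> Omega x -> chi x = ev (p T) x).
Implicit Types (T : 'M[R]_(n.+1, n)) (x z : 'rV[R]_n) (S : {set 'I_n.+1}).

Let aT T : T \in Th -> affinely_independent T.
Proof. by case: ThO => aff _ _ _; exact: aff. Qed.

(** Approach [x] from the interior of the element, along a segment. *)
Lemma extension_eq T x : T \in Th -> simplex T x -> Omega x -> W T x = w x.
Proof.
move=> TTh xT Ox; apply/eqP; rewrite -subr_eq0 -normr_le0; apply/ler_addgt0Pr => e e0.
rewrite add0r; have e20 : 0 < e / 2 by rewrite divr_gt0.
have [d d0 Hd] := within_continuousP oO Ox cw e20.
have v0 : 0 < `|y T - x| + 1 by rewrite ltr_wpDl.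
rewrite (splitr e).
pose D := L * `|y T - x| + 1.
have D0 : 0 < D by rewrite ltr_wpDl// mulr_ge0.
pose t := Num.min 1 (Num.min (d / (`|y T - x| + 1)) (e / 2 / D)) / 2.
have m0 : 0 < Num.min 1 (Num.min (d / (`|y T - x| + 1)) (e / 2 / D)).
  by rewrite !lt_min ltr01 !divr_gt0.
have t0 : 0 < t by rewrite divr_gt0.
have tm : t < Num.min 1 (Num.min (d / (`|y T - x| + 1)) (e / 2 / D)).
  by rewrite /t ltr_pdivrMr// ltr_pMr// ltr1n.
move: tm; rewrite !lt_min => /and3P[t1 td te].
pose z := x + t *: (y T - x).
have zU : (simplex T)° z.
  apply: (simplex_interior_segment (aT TTh) xT (yT TTh)).
  by rewrite t0 ltW.
have zx : `|z - x| = t * `|y T - x| by rewrite /z addrC addKr normrZ gtr0_norm.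
have zd : `|z - x| < d.
  rewrite zx; apply: (@le_lt_trans _ _ (t * (`|y T - x| + 1))).
    by rewrite ler_wpM2l ?(ltW t0)// lerDl.
  by rewrite -ltr_pdivlMr.
have [_ wz] := Hd z zd.
have -> : W T x - w x = (W T x - W T z) + (w z - w x).
  by rewrite -(Ww TTh zU) addrA subrK.
apply: (le_trans (ler_normD _ _)); apply: lerD; last exact: ltW.
apply: (le_trans (WL _ _ TTh)); rewrite distrC zx mulrCA.
apply: (@le_trans _ _ (t * D)); first by rewrite ler_wpM2l ?(ltW t0)// lerDl.
by rewrite -ler_pdivlMr// ltW.
Qed.

(** The relative interior of a face that meets the domain lies in the domain. *)
Lemma face_agree T S x (F1 F2 : 'rV[R]_n -> R) (M : R) : T \in Th ->
  face T S x -> Omega x ->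
  (forall z, simplex T z -> face T S z -> Omega z -> F1 z = F2 z) ->
  (forall z z', simplex T z -> simplex T z' -> `|F1 z - F1 z'| <= M * `|z - z'|) ->
  (forall z z', simplex T z -> simplex T z' -> `|F2 z - F2 z'| <= M * `|z - z'|) ->
  forall z, face T S z -> F1 z = F2 z.
Proof.
move=> TTh xS Ox F12 F1M F2M z zS; have aff := aT TTh.
have S0 : (0 < #|S|)%N.
  rewrite card_gt0; apply/eqP => S0; have := bary_sum aff x.
  rewrite big1 => [/eqP|i _]; first by rewrite eq_sym oner_eq0.
  by have /(faceP aff)[_ ->] := xS; rewrite // S0 finset.in_set0.
pose l (i : 'I_n.+1) : R := (i \in S)%:R / #|S|%:R.
have l1 : \sum_i l i = 1.
  rewrite -mulr_suml -natr_sum (_ : (\sum_i (i \in S))%N = #|S|).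
    by rewrite divff// pnatr_eq0 -lt0n.
  by rewrite -sum1_card [RHS]big_mkcond; apply: eq_bigr => i _; case: (i \in S).
pose z0 := point T l.
have bz0 : bary T z0 =1 l by exact: bary_point.
have z0S : face T S z0.
  apply/(faceP aff); split=> i; rewrite bz0 /l ?divr_ge0// => /negPf ->.
  by rewrite mul0r.
have zT := face_sub_simplex aff zS; have z0T := face_sub_simplex aff z0S.
apply/eqP; rewrite -subr_eq0 -normr_le0.
apply: (@le_eps _ _ _ (M * `|z0 - z| + M * `|z0 - z|)) => t t01; rewrite add0r.
have /andP[t0 t1] := t01.
pose zt := z + t *: (z0 - z).
have ztS : face T S zt by apply: face_segment => //; rewrite (ltW t0).
have ztT := face_sub_simplex aff ztS.
have Ozt : Omega zt.
  apply: (face_interior_sub oO ThO TTh xS Ox ztT) => i.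
  have /(faceP aff)[z_ge0 zS0] := zS.
  rewrite /zt bary_segment// bz0 /l; have [iS|iS] := boolP (i \in S).
    have -> : bary T z i + t * (true%:R / #|S|%:R - bary T z i) =
      (1 - t) * bary T z i + t / #|S|%:R by rewrite /=; ring.
    rewrite ltr_wpDl ?mulr_ge0 ?subr_ge0//.
    by rewrite divr_gt0// ltr0n.
  by rewrite zS0// mul0r subrr mulr0 addr0 ltxx.
have ztE : `|z - zt| = t * `|z0 - z|.
  by rewrite distrC /zt addrC addKr normrZ gtr0_norm.
have -> : F1 z - F2 z = (F1 z - F1 zt) - (F2 z - F2 zt).
  by rewrite (F12 zt)//; ring.
rewrite (le_trans (ler_normB _ _))// mulrDr lerD// mulrCA -ztE.
  exact: F1M.
exact: F2M.
Qed.

Definition local_interp T : mpoly n R := interp N T (fun z => W T z ^+ 2 * ev (p T) z).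

(** Some nodes of a common face may lie on the frontier, where [w] and [chi] are
    junk; there the nodal values from both sides are limits from the relative
    interior of the face. *)
Lemma local_interp_conform T T' x : T \in Th -> T' \in Th ->
  simplex T x -> simplex T' x -> Omega x ->
  ev (local_interp T) x = ev (local_interp T') x.
Proof.
move=> TTh T'Th xT xT' Ox.
have [S [S' [TT FF]]] : exists S S' : {set 'I_n.+1},
    simplex T `&` simplex T' = face T S /\ face T S = face T' S'.
  by case: ThO => _ _ conf _; exact: conf.
have xS : face T S x by rewrite -TT.
have sub z : face T S z -> simplex T' z by rewrite -TT => -[].
have WW := @face_agree T S x (W T) (W T') L TTh xS Ox
  (fun z zT zS Oz => etrans (extension_eq TTh zT Oz)
     (esym (extension_eq T'Th (sub z zS) Oz)))
  (fun z z' _ _ => WL z z' TTh) (fun z z' _ _ => WL z z' T'Th).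
have pp z : face T S z -> ev (p T) z = ev (p T') z.
  pose B := \sum_i `|row i T| + 1.
  have B0 : 0 < B by rewrite ltr_wpDl// sumr_ge0.
  have TB z' : simplex T z' -> `|z'| <= B.
    by move=> /simplex_bounded /le_trans; apply; rewrite lerDl.
  have [L1 L10 H1] := ex_ev_lipschitz (p T) B0.
  have [L2 L20 H2] := ex_ev_lipschitz (p T') B0.
  apply: (@face_agree T S x _ _ (L1 + L2) TTh xS Ox).
  - by move=> z' zT zS Oz; rewrite -!pchi//; exact: sub.
  - move=> z1 z2 /TB b1 /TB b2; apply: le_trans (H1 _ _ b1 b2) _.
    by rewrite ler_wpM2r// lerDl.
  - move=> z1 z2 /TB b1 /TB b2; apply: le_trans (H2 _ _ b1 b2) _.
    by rewrite ler_wpM2r// lerDr.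
apply: (nodes_face_eq (aT TTh) (aT T'Th) N0 FF _ _ _ xS); try exact: msize_interp.
move=> a b aN bN aS ab; rewrite /local_interp interp_node//; last exact: aT.
rewrite ab interp_node//; last exact: aT.
by rewrite -ab WW// pp.
Qed.

Lemma global_interp : exists eta : 'rV[R]_n -> R,
  lagrange_space N.+1 Omega Th eta /\
  forall T x, T \in Th -> simplex T x -> Omega x -> eta x = ev (local_interp T) x.
Proof.
have cover x : exists T, Omega x -> T \in Th /\ simplex T x.
  have [Ox|] := pselect (Omega x); last by exists 0.
  have : closure Omega x by exact: subset_closure.
  by case: ThO => _ -> _ _ [T TTh xT]; exists T.
have /choice[tau tauP] := cover.
pose eta x := ev (local_interp (tau x)) x.
have etaE T x : T \in Th -> simplex T x -> Omega x -> eta x = ev (local_interp T) x.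
  move=> TTh xT Ox; have [tTh xt] := tauP x Ox.
  exact: local_interp_conform.
exists eta; split=> //; split; last first.
  move=> T TTh; exists (local_interp T); split; first exact: msize_interp.
  by move=> x xT Ox; rewrite (etaE T).
rewrite continuous_open_subspace// => x; rewrite inE => Ox.
suff : eta z @[z --> x] --> eta x by [].
apply: (proj2 (@cvgrPdist_lt _ _ _ _ (nbhs_filter x) eta (eta x))) => e e0.
have /choice[dl dlP] : forall T, exists d : R, 0 < d /\ (T \in Th ->
    forall z, Omega z -> simplex T z -> `|z - x| < d -> `|eta x - eta z| < e).
  move=> T; have [TTh|TTh] := boolP (T \in Th); last by exists 1.
  have [xT|xT] := pselect (simplex T x); last first.
    have [d d0 Hd] := open_nsimplex (aT TTh) xT.
    by exists d; split=> // _ z _ zT /Hd.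
  pose B := \sum_i `|row i T| + 1.
  have B0 : 0 < B by rewrite ltr_wpDl// sumr_ge0.
  have TB z : simplex T z -> `|z| <= B.
    by move=> /simplex_bounded /le_trans; apply; rewrite lerDl.
  have [M M0 HM] := ex_ev_lipschitz (local_interp T) B0.
  have M10 : 0 < M + 1 by rewrite ltr_wpDl.
  exists (e / (M + 1)); split; first by rewrite divr_gt0.
  move=> _ z Oz zT zx; rewrite !(etaE T)//.
  apply: le_lt_trans (HM _ _ (TB _ xT) (TB _ zT)) _.
  apply: (@le_lt_trans _ _ ((M + 1) * `|z - x|)).
    by rewrite distrC ler_wpM2r// lerDl.
  by rewrite mulrC -ltr_pdivlMr.
have [d0 d00 Hd0] := open_rowP oO Ox.
pose d := \big[Num.min/d0]_(T <- Th) dl T.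
have dP : 0 < d by apply: lt_bigmin => // T _; have [] := dlP T.
apply: (proj2 (nbhs_normP (x : 'rV[R]_n) _)); exists d => // z /= zx'.
have zx : `|z - x| < d by rewrite distrC.
have Oz : Omega z by apply: Hd0; rewrite (lt_le_trans zx)// bigmin_le_id.
have [tTh zt] := tauP z Oz.
have [_ /(_ tTh z Oz zt)] := dlP (tau z); apply.
by rewrite (lt_le_trans zx)// ge_bigmin_seq.
Qed.

End global.

(** * Superapproximation *)

Lemma closure_norm_le (R : realType) n (D : set 'rV[R]_n) (B : R) :
  (forall x, D x -> `|x| <= B) -> forall x, closure D x -> `|x| <= B.
Proof.
move=> DB x cx; apply/ler_addgt0Pr => e e0.
have [|z [Dz /= zx]] := cx [set z | `|x - z| < e].
  by apply: (proj2 (nbhs_normP (x : 'rV[R]_n) _)); exists e.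
rewrite -[x](subrK z) (le_trans (ler_normD _ _))// addrC lerD//; first exact: DB.
exact: ltW.
Qed.

Lemma hmesh_gt0 (R : realType) n (T : 'M[R]_(n.+1, n)) (C : R) x : 0 < C ->
  simplex T `<=` eball x (C * hmesh T) -> 0 < hmesh T.
Proof.
move=> C0 Tx; have [z zT] := simplex_nonempty T.
have := le_lt_trans (sqrtr_ge0 _) (Tx z zT).
by rewrite pmulr_rgt0.
Qed.

Unset Implicit Arguments.
Set Strict Implicit.

Theorem theorem2p1 (R : realType) (n r : nat) (c1 C1 Comega : R)
    (Omega : set 'rV[R]_n)
    (n_gt0 : (0 < n)%N) (r_ge2 : (2 <= r)%N) (c1_gt0 : 0 < c1) (C1_gt0 : 0 < C1)
    (Omega_polyhedral : polyhedral_domain Omega) :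
  exists C : R, 0 < C /\
  forall (Th : seq 'M[R]_(n.+1, n)) (d : R) (omega : 'rV[R]_n -> R),
    simplicial_decomposition Omega Th ->
    shape_regular c1 C1 Th ->
    0 < d ->
    smooth Omega omega ->
    (forall j : nat, (j <= r)%N ->
       (Wseminorm_oo j Omega omega <= (Comega * d ^- j)%:E)%E) ->
    forall chi : 'rV[R]_n -> R, lagrange_space r Omega Th chi ->
    exists eta : 'rV[R]_n -> R, lagrange_space r Omega Th eta /\
    forall T : 'M[R]_(n.+1, n), T \in Th -> hmesh T <= d ->
      (H1norm (simplex T)° (fun x => omega x ^+ 2 * chi x - eta x)%R
       <= C%:E *
          ((hmesh T / d)%:E *
             L2norm (simplex T)° (fun x => enorm (gradient (fun y => omega y * chi y)%R x))
           + (hmesh T / d ^+ 2)%:E * L2norm (simplex T)° chi))%E.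
Proof.
case: r r_ge2 => // N N0; rewrite ltnS in N0.
have [oO _ _ bO _] := Omega_polyhedral.
have [B [B0 OB]] : exists B : R, 0 < B /\ forall x, closure Omega x -> `|x| <= B.
  have [B [B0 HB]] := pinfty_ex_gt0 bO.
  by exists B; split=> //; apply: closure_norm_le => x Ox; exact: HB.
pose s : R := c1 / (4 * n%:R).
have s0 : 0 < s by rewrite divr_gt0// mulr_gt0// ltr0n.
have s20 : 0 < s / 2 by rewrite divr_gt0.
have [K2 [K20 HK2]] := @grid_control R n N.+1 (s / 2) (ltn0Sn N) s20.
have [K5 [K50 HK5]] := @ex_interp_stable R n N.
pose A : R := `|Comega|.
pose H0 : R := n%:R * (B + B).
pose C : R := `|local_constant n s K2 K5 A H0| + 1.
have C0 : 0 < C by rewrite ltr_wpDl.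
exists C; split=> // Th d w ThO reg d0 sw Ww chi chiL.
have aT T : T \in Th -> affinely_independent T by case: ThO => aff _ _ _; exact: aff.
have hT0 T : T \in Th -> 0 < hmesh T.
  by move=> /reg[_ [x Tx]]; exact: hmesh_gt0 Tx.
have /choice[y yP] : forall T, exists y, T \in Th -> cube y (s * hmesh T) `<=` simplex T.
  move=> T; have [TTh|] := boolP (T \in Th); last by exists 0.
  by have [[y yT] _] := reg T TTh; exists y => _; apply: inscribed_cube => //; exact: hT0.
have yT T : T \in Th -> (simplex T)° (y T).
  move=> TTh; suff : \forall z \near y T, simplex T z by [].
  have sh0 : 0 < s * hmesh T by rewrite mulr_gt0// hT0.
  apply/nbhs_normP; exists (s * hmesh T) => // z /= zy.
  by apply: yP => //=; rewrite /cube /= distrC ltW.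
have UO T : T \in Th -> (simplex T)° `<=` Omega.
  by move=> TTh; exact: (simplex_interior_sub oO ThO).
have Wj (q : seq 'I_n) x : (size q <= 2)%N ->
    sorted (fun i j : 'I_n => (i <= j)%N) q -> Omega x ->
    `|partials q w x| <= A / d ^+ size q.
  move=> q2 sq Ox; apply: le_trans (_ : Comega * d ^- size q <= _).
    have Wq : (Wseminorm_oo (size q) Omega w <= (Comega * d ^- size q)%:E)%E.
      by apply: Ww; rewrite (leq_trans q2).
    exact: (Wseminorm_partials oO sw sq Wq Ox).
  by rewrite ler_wpM2r ?invr_ge0 ?exprn_ge0 ?(ltW d0)// ler_norm.
have wA x : Omega x -> `|w x| <= A.
  by move=> Ox; have := @Wj [::] x isT isT Ox; rewrite /= expr0 divr1.
have gwA i x : Omega x -> `|partial i w x| <= A / d.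
  by move=> Ox; have := @Wj [:: i] x isT isT Ox; rewrite /= expr1.
have ggwA i j x : Omega x -> `|partial j (partial i w) x| <= A / d ^+ 2.
  move=> Ox; have [ij|ji] := leqP i j.
    rewrite (smooth_partial2 i j oO sw Ox).
    by apply: (@Wj [:: i; j] x) => //=; rewrite ij.
  by apply: (@Wj [:: j; i] x) => //=; rewrite ltnW.
have gw T : T \in Th -> has_gradient (simplex T)° w (fun i => partial i w).
  by move=> TTh; exact: has_gradientS (UO T TTh) (smooth_gradient [::] oO sw).
have ggw T i : T \in Th ->
    has_gradient (simplex T)° (partial i w) (fun j => partial j (partial i w)).
  by move=> TTh; exact: has_gradientS (UO T TTh) (smooth_gradient [:: i] oO sw).
pose L : R := n%:R * (A / d).
have L0 : 0 <= L by rewrite mulr_ge0// divr_ge0// ?normr_ge0// ltW.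
pose W T := mcshane (simplex T)° w L.
have WP T : T \in Th -> (forall z, (simplex T)° z -> W T z = w z) /\
    forall z z', `|W T z - W T z'| <= L * `|z - z'|.
  move=> TTh; apply: mcshaneP => //; first by exists (y T); exact: yT.
  apply: (gradient_le_lipschitz (convex_simplex_interior (aT T TTh)) (gw T TTh)).
  by move=> i x /(UO T TTh); exact: gwA.
have [_ chiP] := chiL.
have /choice[p pP] : forall T, exists p : mpoly n R, T \in Th ->
    (msize p <= N.+1)%N /\ forall x, simplex T x -> Omega x -> chi x = ev p x.
  move=> T; have [TTh|] := boolP (T \in Th); last by exists 0.
  by have [p pT] := chiP T TTh; exists p.
have cw : {within Omega, continuous w} by have [] := sw [::].
have [eta [etaL etaE]] := @global_interp R n N Omega Th N0 oO ThO w chi L W p y L0 cw yT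
  (fun T x z TTh => (WP T TTh).2 x z) (fun T x TTh => (WP T TTh).1 x)
  (fun T x TTh => (pP T TTh).2 x).
exists eta; split=> // T TTh _.
have TO x : (simplex T)° x -> Omega x by exact: UO.
apply: (@local_estimate R n N s K2 K5 A n_gt0 N0 s0 K20 K50 HK2 HK5 T (y T) (hmesh T) d
  w (W T) (p T) (aT T TTh) (hT0 T TTh) d0 _ (yP T TTh) (pP T TTh).1 (gw T TTh)
  (fun i => ggw T i TTh) _ _ _ (WP T TTh).2 (WP T TTh).1 H0) => //.
- by move=> x z; exact: simplex_diameter.
- by move=> x /TO; exact: wA.
- by move=> i x /TO; exact: gwA.
- by move=> i j x /TO; exact: ggwA.
- apply: diameter_le => //; first exact: ltW.
    exact: simplex_nonempty.
  by move=> z zT; apply: OB; exact: (simplex_closure ThO TTh).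
- move=> x xT; apply: (pP T TTh).2; [exact: interior_subset|exact: TO].
- move=> x xT; apply: etaE => //; [exact: interior_subset|exact: TO].
- by rewrite /C (le_trans (ler_norm _))// lerDl.
Qed.
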